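(* Let $\phi$ be a $\Xi$-regular Anderson $A$-module of dimension $d$ with abelian $A$-motive $M$ and $A$-finite dual $A$-motive $N$, and let $D\subseteq\mathbb{C}_\infty^d$ be the domain of convergence of $\mathrm{Log}_\phi$. Then for every $\mathbf z\in D\cap L^d$, \[G(1,1;\mathbf z):=\sum_{i=0}^\infty\sum_{k=1}^d\delta_0^N\Big(\sigma^{-i}(h_k)\,\delta^M_{1,\mathbf z}\big(\tau^i(g_k)\big)\Big)\] converges and equals $\mathrm{Log}_\phi(\mathbf z)$.
   Context: Let $\mathbb{F}_q$ be the finite field with $q$ elements, $X$ a smooth projective geometrically connected curve over $\mathbb{F}_q$ with a fixed rational point $\infty$, $K$ its function field, $A\subset K$ the ring of functions regular away from $\infty$, $K_\infty$ the completion of $K$ at $\infty$, $\mathbb{C}_\infty$ the completion of an algebraic closure of $K_\infty$, and $L$ an algebraically closed field with $K\subseteq L\subseteq\mathbb{C}_\infty$. Tensor products are over $\mathbb{F}_q$; $L\otimes A$ is a domain with fraction field $Q$. For $h=\sum_j\ell_j\otimes f_j$ and $i\in\mathbb{Z}$ put $h^{(i)}=\sum_j\ell_j^{q^i}\otimes f_j$ (extended to $Q$, and entrywise to vectors and matrices; for $v\in\mathbb{C}_\infty^d$, $v^{(i)}$ raises each entry to the $q^i$-th power). $(L\otimes A)[\tau]$ is the skew polynomial ring with $\tau h=h^{(1)}\tau$, and $(L\otimes A)[\sigma]$ the one with $\sigma h=h^{(-1)}\sigma$; $L$, $A$ are identified with $L\otimes1$, $1\otimes A$. For $i\in\mathbb{Z}$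 let $J^{(i)}\subset L\otimes A$ be the ideal generated by all $1\otimes a-a^{q^i}\otimes1$ ($a\in A$), $J=J^{(0)}$; an element of $Q$ is regular at $\Xi^{(i)}$ if it lies in $(L\otimes A)_{J^{(i)}}$. An Anderson $A$-module of dimension $d$ is an $\mathbb{F}_q$-algebra homomorphism $\phi:A\to\mathrm{Mat}_d(L)[\tau]$, $\phi_a=d[a]+\sum_{i\ge1}A_{a,i}\tau^i$, with $d[a]=aI_d+N_a$, $N_a$ nilpotent; $\tau$ acts on $\mathbb{C}_\infty^d$ by raising entries to the $q$-th power. Its logarithm $\mathrm{Log}_\phi(\mathbf z)=\sum_{i\ge0}P_i\mathbf z^{(i)}$ is the formal inverse of the exponential; equivalently the unique $\mathbb{F}_q$-linear power series with $P_i\in\mathrm{Mat}_d(\mathbb{C}_\infty)$, $P_0=I_d$, and $\mathrm{Log}_\phi(\phi_a(\mathbf z))=d[a]\mathrm{Log}_\phi(\mathbf z)$ for all $a\in A$; it converges on a bounded domain $D$. For $\beta=\sum_iB_i\tau^i$ put $\beta^*=\sum_i(B_i^\top)^{(-i)}\sigma^i$. Let $M=\mathrm{Mat}_{1\times d}(L[\tau])$ with $a\cdot m=m\phi_a$, $\ell\cdot m=\ell m$, $\tau\cdot m=\tau m$, and $N=\mathrm{Mat}_{1\times d}(L[\sigma])$ with $a\cdot n=n\phi_a^*$, $\ell\cdot n=\ell n$, $\sigma\cdot n=\sigma n$ ($a\in A,\ell\in L$). Standing assumption: $M$ and $N$ are finitely generated projective $L\otimes A$-modules of constant rank $r$ with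 $J^nM\subseteq\tau M$, $J^nN\subseteq\sigma N$ for $n$ large. Let $g_1,\dots,g_d$ (resp. $h_1,\dots,h_d$) be the standard basis row vectors of $M$ over $L[\tau]$ (resp. $N$ over $L[\sigma]$). For $m=(m_1,\dots,m_d)\in M$ and $\mathbf z=(z_1,\dots,z_d)^\top\in L^d$, $\delta^M_{1,\mathbf z}(m)=m(\mathbf z)=\sum_km_k(z_k)\in L$, where $\tau^j$ acts on $L$ as $z\mapsto z^{q^j}$ (so $\delta^M_{1,\mathbf z}(\tau^i g_k)=z_k^{q^i}$). For $n=\sum_k\sum_{j\ge0}c_{k,j}\sigma^jh_k\in N$ let $\delta_0^N(n)=(c_{1,0},\dots,c_{d,0})^\top$; it is $L$-linear and vanishes on $\sigma N\supseteq J^nN$, so factors through $N/J^nN\cong N_J/J^nN_J$ and extends to $N_J=N\otimes_{L\otimes A}(L\otimes A)_J$. On $N_Q=N\otimes_{L\otimes A}Q$, $\sigma(n\otimes f)=\sigma n\otimes f^{(-1)}$ is bijective; $\sigma^{-1}$ is its inverse. $\phi$ is $\Xi$-regular if there are $L\otimes K$-bases $c_1,\dots,c_r$ of $M\otimes_AK$ and $d_1,\dots,d_r$ of $N\otimes_AK$ and $\Phi\in\mathrm{Mat}_r(L\otimes K)$ with $\tau(c_1,\dots,c_r)^\top=\Phi(c_1,\dots,c_r)^\top$, $\sigma(d_1,\dots,d_r)^\top=\Phi^\top(d_1,\dots,d_r)^\top$, and $\det\Phi$ and all entries of $\Phi$ regular at every $\Xi^{(i)}$, $i\in\mathbb{Z}$;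 then $\sigma^{-i}(n)\in N_J$ for $n\in N$, $i\ge0$, so the terms of $G(1,1;\mathbf z)$ are defined. *)

(* Defs.v *)
From HB Require Import structures.
From mathcomp Require Import all_boot all_order all_algebra pgroup abelian finfield.
From mathcomp Require Import boolp classical_sets reals topology normedtype.

Set Implicit Arguments.
Unset Strict Implicit.
Unset Printing Implicit Defensive.

Import Order.TTheory GRing.Theory Num.Theory.
Import numFieldNormedType.Exports.

Local Open Scope classical_set_scope.
Local Open Scope ring_scope.

(* skewpoly s is the ring of polynomials \sum_i p_i X^i over R with           *)
(* X c = (s c) X; the carrier is {poly R} with coefficients on the left.      *)
Definition skewpoly (R : nzRingType) (s : {rmorphism R -> R}) : Type := {poly R}.

Section SkewPoly.
Variables (R : nzRingType) (s : {rmorphism R -> R}).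
Implicit Types p q r : skewpoly s.

HB.instance Definition _ := GRing.Zmodule.copy (skewpoly s) {poly R}.

Definition skewcoef p (i : nat) : R := (p : {poly R})`_i.
Definition skewC (c : R) : skewpoly s := c%:P.
Definition skewX : skewpoly s := ('X : {poly R}).

Definition skewmul p q : skewpoly s :=
  \poly_(n < (size (p : {poly R}) + size (q : {poly R})).-1)
     \sum_(i < n.+1) skewcoef p i * iter i s (skewcoef q (n - i)).

Let siterD i : {morph iter i s : x y / x + y}.
Proof. by elim: i => // i IH x y; rewrite !iterS IH rmorphD. Qed.
Let siterM i : {morph iter i s : x y / x * y}.
Proof. by elim: i => // i IH x y; rewrite !iterS IH rmorphM. Qed.
Let siter0 i : iter i s 0 = 0.
Proof. by elim: i => // i IH; rewrite iterS IH rmorph0. Qed.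
Let siter1 i : iter i s 1 = 1.
Proof. by elim: i => // i IH; rewrite iterS IH rmorph1. Qed.

Lemma skewpolyP p q : (forall i, skewcoef p i = skewcoef q i) <-> p = q.
Proof. by split=> [h|-> //]; apply/polyP. Qed.

Lemma skewcoefD p q i : skewcoef (p + q) i = skewcoef p i + skewcoef q i.
Proof. exact: coefD. Qed.

Lemma skewcoefC c i : skewcoef (skewC c) i = if i == 0%N then c else 0.
Proof. exact: coefC. Qed.

Lemma skewcoefX i : skewcoef skewX i = (i == 1%N)%:R.
Proof. exact: coefX. Qed.

Lemma skewcoef_mul p q n : skewcoef (skewmul p q) n =
  \sum_(i < n.+1) skewcoef p i * iter i s (skewcoef q (n - i)).
Proof.
rewrite /skewcoef coef_poly ltn_predRL; case: leqP => // le_pq_n.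
rewrite big1 // => j _; have [lq_p_j|lt_j_p] := leqP (size (p : {poly R})) j.
  by rewrite nth_default ?mul0r.
rewrite [X in iter _ _ X]nth_default ?siter0 ?mulr0 // leq_subRL -ltnS //.
by rewrite (leq_trans _ le_pq_n) // ltn_add2r.
Qed.

Fact skewmulA : associative skewmul.
Proof.
move=> p q r; apply/skewpolyP => n; rewrite !skewcoef_mul.
pose c3 i k := skewcoef p i *
  (iter i s (skewcoef q (k - i)) * iter k s (skewcoef r (n - k))).
transitivity (\sum_(i < n.+1) \sum_(k < n.+1 | (i <= k)%N) c3 i k); last first.
  rewrite (exchange_big_dep predT) //=; apply: eq_bigr => k _.
  rewrite skewcoef_mul big_distrl /=.
  rewrite (big_ord_widen_cond n.+1 predT
    (fun i => skewcoef p i * iter i s (skewcoef q (k - i)) *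
              iter k s (skewcoef r (n - k)))) //=.
  by apply: eq_big => [i|i _]; rewrite /c3 ?mulrA ?ltnS.
apply: eq_bigr => i _; rewrite skewcoef_mul.
have -> : iter i s (\sum_(j < (n - i).+1) skewcoef q j *
   iter j s (skewcoef r (n - i - j))) = \sum_(j < (n - i).+1)
   iter i s (skewcoef q j) * iter (i + j) s (skewcoef r (n - (i + j))).
  rewrite (big_morph _ (siterD i) (siter0 i)); apply: eq_bigr => j _.
  by rewrite siterM -iterD subnDA.
rewrite big_distrr /=.
rewrite -(big_mkord predT (fun j => skewcoef p i * (iter i s (skewcoef q j) *
  iter (i + j) s (skewcoef r (n - (i + j)))))).
rewrite -(big_mkord (fun k => (i <= k)%N) (c3 i)).
rewrite -(big_nat_widenl i 0 n.+1 predT (c3 i)) //.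
rewrite -{6}[nat_of_ord i]add0n big_addn subSn ?leq_ord //.
apply: eq_bigr => j _.
by rewrite /c3 addnK (addnC j).
Qed.

Fact skewmul1l : left_id (skewC 1) skewmul.
Proof.
move=> p; apply/skewpolyP => n; rewrite skewcoef_mul big_ord_recl subn0.
by rewrite big1 => [|i _]; rewrite skewcoefC ?mul0r // mul1r addr0.
Qed.

Fact skewmul1r : right_id (skewC 1) skewmul.
Proof.
move=> p; apply/skewpolyP => n; rewrite skewcoef_mul big_ord_recr /= subnn.
rewrite skewcoefC siter1 mulr1 big1 ?add0r // => i _.
by rewrite skewcoefC subn_eq0 leqNgt ltn_ord siter0 mulr0.
Qed.

Fact skewmulDl : left_distributive skewmul +%R.
Proof.
move=> p q r; apply/skewpolyP => n.
rewrite skewcoefD !skewcoef_mul -big_split /=.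
by apply: eq_bigr => i _; rewrite skewcoefD mulrDl.
Qed.

Fact skewmulDr : right_distributive skewmul +%R.
Proof.
move=> p q r; apply/skewpolyP => n.
rewrite skewcoefD !skewcoef_mul -big_split /=.
by apply: eq_bigr => i _; rewrite skewcoefD siterD mulrDr.
Qed.

Fact skewC1_neq0 : skewC 1 != 0.
Proof. by rewrite polyC_eq0 oner_neq0. Qed.

HB.instance Definition _ := GRing.Zmodule_isNzRing.Build (skewpoly s)
  skewmulA skewmul1l skewmul1r skewmulDl skewmulDr skewC1_neq0.

Lemma skewcoefM p q n : skewcoef (p * q) n =
  \sum_(i < n.+1) skewcoef p i * iter i s (skewcoef q (n - i)).
Proof. exact: skewcoef_mul. Qed.

Lemma skewcoef_is_zmod_morphism i : zmod_morphism (skewcoef^~ i).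
Proof. by move=> p q; exact: coefB. Qed.

Fact skewC_is_zmod_morphism : zmod_morphism skewC.
Proof. by move=> a b; exact: polyCB. Qed.

Fact skewC_is_monoid_morphism : monoid_morphism skewC.
Proof.
split=> // a b; apply/skewpolyP => n; rewrite skewcoefM big_ord_recl subn0 /=.
rewrite big1 ?addr0 => [|i _]; rewrite !skewcoefC ?mul0r //.
by case: eqP; rewrite ?mulr0.
Qed.

HB.instance Definition _ :=
  GRing.isZmodMorphism.Build R (skewpoly s) skewC skewC_is_zmod_morphism.
HB.instance Definition _ :=
  GRing.isMonoidMorphism.Build R (skewpoly s) skewC skewC_is_monoid_morphism.

Lemma skewC_central c p : s c = c -> (forall x : R, x * c = c * x) ->
  skewC c * p = p * skewC c.
Proof.
move=> sc cc; apply/skewpolyP => n; rewrite !skewcoefM big_ord_recl subn0 /=.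
rewrite big1 ?addr0 => [|i _]; last by rewrite skewcoefC mul0r.
rewrite big_ord_recr /= subnn big1 ?add0r => [|i _]; last first.
  by rewrite skewcoefC subn_eq0 leqNgt ltn_ord siter0 mulr0.
by rewrite !skewcoefC /= (iter_fix n sc) cc.
Qed.

End SkewPoly.

Section Frobenius.
Variables (F : finFieldType) (L : closedFieldType) (i : {rmorphism F -> L}).

(* i is only there to ensure that #|F| is a power of the characteristic of L. *)
Definition frob of {rmorphism F -> L} := fun x : L => x ^+ #|F|.

Let card_pnat : [pchar L].-nat #|F|.
Proof.
have [p p_pr pF] := finPcharP F.
have pL : p \in [pchar L] by rewrite (fmorph_pchar i).
rewrite (eq_pnat _ (pcharf_eq pL)) -cardsT.
exact: abelem_pgroup (fin_ring_pchar_abelem pF).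
Qed.

Fact frob_is_zmod_morphism : zmod_morphism (frob i).
Proof. by move=> x y; rewrite /frob exprDn_pchar // exprNn_pchar. Qed.

Fact frob_is_monoid_morphism : monoid_morphism (frob i).
Proof. by split=> [|x y]; rewrite /frob ?expr1n ?exprMn. Qed.

HB.instance Definition _ :=
  GRing.isZmodMorphism.Build L L (frob i) frob_is_zmod_morphism.
HB.instance Definition _ :=
  GRing.isMonoidMorphism.Build L L (frob i) frob_is_monoid_morphism.

Fact frob_surj x : exists y, frob i y == x.
Proof.
have q_gt0 : (0 < #|F|)%N by rewrite (cardD1 0).
have [y hy] := solve_monicpoly (fun k => if k == 0%N then x else 0) q_gt0.
exists y; rewrite /frob hy -(prednK q_gt0) big_ord_recl /= expr0 mulr1.
by rewrite big1 ?addr0 // => k _; rewrite mul0r.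
Qed.

Definition frobV (x : L) : L := xchoose (frob_surj x).

Lemma frobVK : cancel frobV (frob i).
Proof. by move=> x; apply/eqP; exact: xchooseP (frob_surj x). Qed.

Lemma frobK : cancel (frob i) frobV.
Proof. by move=> x; apply: (fmorph_inj (frob i)); rewrite /= frobVK. Qed.

Fact frobV_is_zmod_morphism : zmod_morphism frobV.
Proof.
by move=> x y; apply: (fmorph_inj (frob i)); rewrite rmorphB /= !frobVK.
Qed.

Fact frobV_is_monoid_morphism : monoid_morphism frobV.
Proof.
by split=> [|x y]; apply: (fmorph_inj (frob i));
  rewrite ?rmorph1 ?rmorphM /= !frobVK.
Qed.

HB.instance Definition _ :=
  GRing.isZmodMorphism.Build L L frobV frobV_is_zmod_morphism.
HB.instance Definition _ :=
  GRing.isMonoidMorphism.Build L L frobV frobV_is_monoid_morphism.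

Definition frobz (n : int) (x : L) : L :=
  match n with
  | Posz m => iter m (frob i) x
  | Negz m => iter m.+1 frobV x
  end.

Lemma frob_cst (c : F) : frob i (i c) = i c.
Proof. by rewrite /frob -rmorphXn /= expf_card. Qed.

Lemma frobV_cst (c : F) : frobV (i c) = i c.
Proof. by rewrite -{1}frob_cst frobK. Qed.

End Frobenius.

Definition balanced (R : Type) (U V W : zmodType)
    (aU : R -> U -> U) (aV : R -> V -> V) (f : U -> V -> W) : Prop :=
  [/\ forall u u' v, f (u + u') v = f u v + f u' v,
      forall u v v', f u (v + v') = f u v + f u v'
    & forall r u v, f (aU r u) v = f u (aV r v)].

(* (W, t) is the tensor product of the R-modules U and V, with R-actions aU   *)
(* and aV.                                                                    *)
Definition is_tensor_product (R : Type) (U V W : zmodType)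
    (aU : R -> U -> U) (aV : R -> V -> V) (t : U -> V -> W) : Prop :=
  balanced aU aV t /\
  forall (Z : zmodType) (f : U -> V -> Z), balanced aU aV f ->
    exists! g : W -> Z,
      {morph g : x y / x + y} /\ forall u v, g (t u v) = f u v.

(* The additive map W -> Z sending t u v to f u v, whenever there is one.     *)
Definition tensor_lift (U V W Z : zmodType) (t : U -> V -> W)
    (f : U -> V -> Z) : W -> Z :=
  match pselect (exists g : W -> Z,
    {morph g : x y / x + y} /\ forall u v, g (t u v) = f u v) with
  | left h => projT1 (cid h)
  | right _ => fun=> 0
  end.

Section TensorLift.
Variables (R : Type) (U V W Z : zmodType).
Variables (aU : R -> U -> U) (aV : R -> V -> V) (t : U -> V -> W).
Hypothesis tP : is_tensor_product aU aV t.

Lemma tensor_liftP (f : U -> V -> Z) : balanced aU aV f ->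
  {morph tensor_lift t f : x y / x + y} /\
  forall u v, tensor_lift t f (t u v) = f u v.
Proof.
move=> fP; rewrite /tensor_lift; case: pselect => [h|[]].
  by case: (cid h).
by have [g [gP _]] := tP.2 _ _ fP; exists g.
Qed.

Lemma tensor_eq (g h : W -> Z) :
    {morph g : x y / x + y} -> {morph h : x y / x + y} ->
  (forall u v, g (t u v) = h (t u v)) -> g =1 h.
Proof.
move=> gD hD gh; have [tl tr tb] := tP.1.
have fP : balanced aU aV (fun u v => g (t u v)).
  by split=> *; rewrite ?tl ?tr ?tb.
have [k [_ uk]] := tP.2 _ _ fP.
have kg : k = g by exact: uk.
have kh : k = h by apply: uk; split=> // u v; rewrite gh.
by move=> w; rewrite -kg kh.
Qed.

End TensorLift.

Record commuting_actions (F : Type) (L A : nzRingType) (fL : F -> L)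
    (fA : F -> A) (V : zmodType) (lact : L -> V -> V) (aact : A -> V -> V) :
    Prop := CommutingActions {
  lactDl : forall v, {morph lact^~ v : l l' / l + l'};
  lactDr : forall l, {morph lact l : v v' / v + v'};
  lact1 : forall v, lact 1 v = v;
  lactM : forall l l' v, lact (l * l') v = lact l (lact l' v);
  aactDl : forall v, {morph aact^~ v : a a' / a + a'};
  aactDr : forall a, {morph aact a : v v' / v + v'};
  aact1 : forall v, aact 1 v = v;
  aactM : forall a a' v, aact (a * a') v = aact a (aact a' v);
  laactC : forall l a v, lact l (aact a v) = aact a (lact l v);
  laact_cst : forall c v, lact (fL c) v = aact (fA c) v
}.

(* The T-module V, where T is the tensor product over F of L and A, attached  *)
(* to commuting actions of L and A on V.                                      *)
Definition tensor_module (F : Type) (L A T : comNzRingType)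
    (iL : {rmorphism L -> T}) (iA : {rmorphism A -> T})
    (fL : F -> L) (fA : F -> A)
    of is_tensor_product (fun c l => fL c * l) (fun c a => fA c * a)
         (fun l a => iL l * iA a) :=
  fun (V : zmodType) (lact : L -> V -> V) (aact : A -> V -> V)
      of commuting_actions fL fA lact aact => (V : Type).

Section TensorModule.
Variables (F : Type) (L A T : comNzRingType).
Variables (iL : {rmorphism L -> T}) (iA : {rmorphism A -> T}).
Variables (fL : F -> L) (fA : F -> A).
Hypothesis tP : is_tensor_product (fun c l => fL c * l) (fun c a => fA c * a)
  (fun l a => iL l * iA a).
Variables (V : zmodType) (lact : L -> V -> V) (aact : A -> V -> V).
Hypothesis laP : commuting_actions fL fA lact aact.

Local Notation mod := (tensor_module tP laP).

HB.instance Definition _ := GRing.Zmodule.copy mod V.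

Definition tensor_scale (t : T) (v : V) : V :=
  tensor_lift (fun l a => iL l * iA a) (fun l a => lact l (aact a v)) t.

Let bal v : balanced (fun c l => fL c * l) (fun c a => fA c * a)
  (fun l a => lact l (aact a v)).
Proof.
split=> [l l' a|l a a'|c l a].
- by rewrite (lactDl laP).
- by rewrite (aactDl laP) (lactDr laP).
- by rewrite mulrC (lactM laP) (laact_cst laP) -(aactM laP).
Qed.

Lemma tensor_scale_pure l a v :
  tensor_scale (iL l * iA a) v = lact l (aact a v).
Proof. exact: (tensor_liftP tP (bal v)).2. Qed.

Fact tensor_scaleDl v : {morph tensor_scale^~ v : s t / s + t}.
Proof. exact: (tensor_liftP tP (bal v)).1. Qed.

Fact tensor_scaleDr : right_distributive tensor_scale +%R.
Proof.
move=> t v v'; apply: (tensor_eq tP (g := tensor_scale^~ (v + v'))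
  (h := fun t => tensor_scale t v + tensor_scale t v')) => [|s s'|l a].
- exact: tensor_scaleDl.
- by rewrite !tensor_scaleDl addrACA.
- by rewrite !tensor_scale_pure (aactDr laP) (lactDr laP).
Qed.

Fact tensor_scale1 : left_id 1 tensor_scale.
Proof.
move=> v; rewrite -[1]mul1r -{1}(rmorph1 iL) -(rmorph1 iA) tensor_scale_pure.
by rewrite (lact1 laP) (aact1 laP).
Qed.

Fact tensor_scaleA s t v :
  tensor_scale s (tensor_scale t v) = tensor_scale (s * t) v.
Proof.
move: s; apply: (tensor_eq tP (g := fun s => tensor_scale s (tensor_scale t v))
  (h := fun s => tensor_scale (s * t) v)) => [|s s'|l a].
- exact: tensor_scaleDl.
- by rewrite mulrDl tensor_scaleDl.
move: t; apply: (tensor_eq tP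
  (g := fun t => tensor_scale (iL l * iA a) (tensor_scale t v))
  (h := fun t => tensor_scale (iL l * iA a * t) v)) => [t t'|t t'|l' a'].
- by rewrite tensor_scaleDl tensor_scaleDr.
- by rewrite mulrDr tensor_scaleDl.
rewrite mulrACA -!rmorphM !tensor_scale_pure (lactM laP) (aactM laP).
by rewrite (laactC laP l' a).
Qed.

HB.instance Definition _ := GRing.Zmodule_isLmodule.Build T mod
  tensor_scaleA tensor_scale1 tensor_scaleDr tensor_scaleDl.

End TensorModule.

(* The curve X is given by its function field: a smooth projective            *)
(* geometrically connected curve over a finite field F is the same thing as a *)
(* finitely generated extension K / F of transcendence degree 1 in which F is *)
(* algebraically closed, the closed points being the normalized discrete      *)
(* valuations of K that are trivial on F.                                     *)
Definition is_function_field (F : finFieldType) (K : fieldType)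
    (i : {rmorphism F -> K}) : Prop :=
  (exists x : K, ~ algebraicOver i x /\
     exists (n : nat) (e : 'I_n -> K), forall f : K,
     exists u v : 'I_n -> {poly F},
       (forall k, v k != 0) /\
       f = \sum_k (map_poly i (u k)).[x] / (map_poly i (v k)).[x] * e k) /\
  forall f : K, algebraicOver i f -> exists c : F, f = i c.

(* The order of vanishing of 0 is the junk value 0.                           *)
Record is_place (F : finFieldType) (K : fieldType) (i : {rmorphism F -> K})
    (v : K -> int) : Prop := IsPlace {
  place_cst : forall c : F, v (i c) = 0;
  placeM : forall x y, x != 0 -> y != 0 -> v (x * y) = v x + v y;
  placeD : forall x y, x != 0 -> y != 0 -> x + y != 0 ->
    Num.min (v x) (v y) <= v (x + y);
  place_normalized : exists2 x, x != 0 & v x = 1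
}.

Record curve (F : finFieldType) := Curve {
  funfield : fieldType;
  cstK : {rmorphism F -> funfield};
  ord_infty : funfield -> int;
  funfieldP : is_function_field cstK;
  ord_inftyP : is_place cstK ord_infty;
  infty_rational : forall f, f != 0 -> 0 <= ord_infty f ->
    exists c : F, f = cstK c \/ 0 < ord_infty (f - cstK c)
}.

Arguments ord_infty {F} X f : rename.

Section AffineRing.
Variables (F : finFieldType) (X : curve F).
Local Notation K := (funfield X).

Definition regular_away_infty : {pred K} := fun f =>
  `[< forall v, is_place (cstK X) v -> v <> ord_infty X ->
      f != 0 -> 0 <= v f >].

Fact regular_cst c : cstK X c \in regular_away_infty.
Proof. by apply/asboolP => v vP _ _; rewrite (place_cst vP). Qed.

Fact regular_subring_closed : subring_closed regular_away_infty.
Proof.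
have vN v (f : K) : is_place (cstK X) v -> f != 0 -> v (- f) = v f.
  move=> vP f0; rewrite -mulN1r (placeM vP) ?oppr_eq0 ?oner_eq0 //.
  by rewrite -(rmorph1 (cstK X)) -rmorphN (place_cst vP) add0r.
split=> [|f g /asboolP fP /asboolP gP|f g /asboolP fP /asboolP gP].
- by rewrite -(rmorph1 (cstK X)) regular_cst.
- apply/asboolP => v vP vi fg0.
  have [f0|f0] := eqVneq f 0.
    move: fg0; rewrite f0 sub0r oppr_eq0 => g0.
    by rewrite vN //; exact: gP.
  have [g0|g0] := eqVneq g 0.
    by rewrite g0 subr0; exact: fP.
  apply: le_trans (placeD vP f0 _ fg0); last by rewrite oppr_eq0.
  by rewrite le_min fP //= vN //; exact: gP.
- apply/asboolP => v vP vi; rewrite mulf_eq0 negb_or => /andP[f0 g0].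
  by rewrite (placeM vP) //; apply: addr_ge0; [exact: fP|exact: gP].
Qed.

HB.instance Definition _ := GRing.isSubringClosed.Build K regular_away_infty
  regular_subring_closed.

Record affine := Affine {
  affine_val :> K;
  affine_regular : affine_val \in regular_away_infty
}.

HB.instance Definition _ := [isSub for affine_val].
HB.instance Definition _ := [Choice of affine by <:].
HB.instance Definition _ := [SubChoice_isSubComNzRing of affine by <:].

Definition cstA (c : F) : affine := Affine (regular_cst c).

End AffineRing.

Section AbsoluteValues.
Variable R : realType.

Record nonarch_abs (E : fieldType) (abs : E -> R) : Prop := NonarchAbs {
  nabs_ge0 : forall x, 0 <= abs x;
  nabs_eq0 : forall x, abs x = 0 <-> x = 0;
  nabsM : forall x y, abs (x * y) = abs x * abs y;
  nabsD : forall x y, abs (x + y) <= Num.max (abs x) (abs y)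
}.

Definition abs_cvg (E : fieldType) (abs : E -> R) (u : nat -> E) (l : E) :=
  (fun n => abs (u n - l)) @ \oo --> (0 : R).

Definition abs_cauchy (E : fieldType) (abs : E -> R) (u : nat -> E) :=
  forall e : R, 0 < e -> exists N, forall m n,
    (N <= m)%N -> (N <= n)%N -> abs (u m - u n) < e.

Record is_completion (E E' : fieldType) (abs : E -> R) (abs' : E' -> R)
    (i : {rmorphism E -> E'}) : Prop := IsCompletion {
  completion_abs : nonarch_abs abs';
  completion_isom : forall x, abs' (i x) = abs x;
  completion_dense : forall y (e : R), 0 < e -> exists x, abs' (y - i x) < e;
  completion_complete : forall u, abs_cauchy abs' u ->
    exists l, abs_cvg abs' u l
}.

Variable F : finFieldType.

Definition abs_infty (X : curve F) (f : funfield X) : R :=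
  if f == 0 then 0 else #|F|%:R ^ (- ord_infty X f).

(* The fields K_oo, an algebraic closure of it, and its completion C_oo, each *)
(* with the absolute value extending abs_infty.                               *)
Record infty_fields (X : curve F) := InftyFields {
  Kinf : fieldType;
  Kinf_abs : Kinf -> R;
  K_Kinf : {rmorphism funfield X -> Kinf};
  Kinf_completion : is_completion (@abs_infty X) Kinf_abs K_Kinf;
  Kbar : closedFieldType;
  Kbar_abs : Kbar -> R;
  Kinf_Kbar : {rmorphism Kinf -> Kbar};
  Kbar_algebraic : forall x, algebraicOver Kinf_Kbar x;
  Kbar_absP : nonarch_abs Kbar_abs;
  Kbar_abs_ext : forall x, Kbar_abs (Kinf_Kbar x) = Kinf_abs x;
  Cinf : fieldType;
  Cinf_abs : Cinf -> R;
  Kbar_Cinf : {rmorphism Kbar -> Cinf};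
  Cinf_completion : is_completion Kbar_abs Cinf_abs Kbar_Cinf
}.

End AbsoluteValues.

Arguments Kinf_abs {R F X} I x : rename.
Arguments Kbar_abs {R F X} I x : rename.
Arguments Cinf_abs {R F X} I x : rename.

Record coeff_field (R : realType) (F : finFieldType) (X : curve F)
    (I : infty_fields R X) := CoeffField {
  coeff_sort :> closedFieldType;
  K_L : {rmorphism funfield X -> coeff_sort};
  L_C : {rmorphism coeff_sort -> Cinf I};
  K_L_C : forall f, L_C (K_L f) = Kbar_Cinf I (Kinf_Kbar I (K_Kinf I f))
}.

Section CoefficientField.
Variables (R : realType) (F : finFieldType) (X : curve F).
Variables (I : infty_fields R X) (L : coeff_field I).

Definition cstL : {rmorphism F -> L} := K_L L \o cstK X.
Definition A_L (a : affine X) : L := K_L L (affine_val a).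

Local Notation Ltau := (skewpoly (frob cstL)).
Local Notation Lsigma := (skewpoly (frobV cstL)).

Definition coefmx m n (j : nat) (B : 'M[Ltau]_(m, n)) : 'M[L]_(m, n) :=
  map_mx (fun p : Ltau => skewcoef p j) B.

Definition tau : Ltau := skewX (frob cstL).
Definition sigma : Lsigma := skewX (frobV cstL).

Definition tau_eval (p : Ltau) (x : L) : L :=
  \sum_(j < size (p : {poly L})) skewcoef p j * x ^+ (#|F| ^ j).

(* B_j^(-j) sigma^j is the adjoint of B_j tau^j for B_j in L.                 *)
Definition skewadj (p : Ltau) : Lsigma :=
  \poly_(j < size (p : {poly L})) frobz cstL (- j%:Z) (skewcoef p j).

Definition adjmx m n (B : 'M[Ltau]_(m, n)) : 'M[Lsigma]_(n, m) :=
  (map_mx skewadj B)^T.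

Record anderson (d : nat) := Anderson {
  anderson_fun :> {rmorphism affine X -> 'M[Ltau]_d};
  anderson_cst : forall c : F,
    anderson_fun (cstA X c) = (skewC (frob cstL) (cstL c))%:M;
  anderson_nilpotent : forall a, exists k : nat,
    (coefmx 0 (anderson_fun a) - (A_L a)%:M) ^+ k = 0
}.

(* A ring LA identified with the tensor product of L and A over F, where      *)
(* LA_L l is l (x) 1 and LA_A a is 1 (x) a.                                   *)
Record tensorLA := TensorLA {
  LA_sort :> idomainType;
  LA_L : {rmorphism L -> LA_sort};
  LA_A : {rmorphism affine X -> LA_sort};
  LA_tensor : is_tensor_product (fun (c : F) (l : L) => cstL c * l)
    (fun (c : F) (a : affine X) => cstA X c * a)
    (fun l a => LA_L l * LA_A a)
}.

End CoefficientField.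

Notation Ltau L := (skewpoly (frob (cstL L))).
Notation Lsigma L := (skewpoly (frobV (cstL L))).

Section MotiveActions.
Variables (R : realType) (F : finFieldType) (X : curve F).
Variables (I : infty_fields R X) (L : coeff_field I).
Variables (d : nat) (phi : anderson L d).

Lemma mul_row_scalar_central (S : nzRingType) (m : 'rV[S]_d) (c : S) :
  (forall x, c * x = x * c) -> m *m c%:M = c *: m.
Proof.
move=> cC; apply/rowP => j; rewrite !mxE (bigD1 j) //= big1 => [|k kj].
  by rewrite mxE eqxx mulr1n addr0 cC.
by rewrite mxE (negPf kj) mulr0n mulr0.
Qed.

Fact motive_actions : commuting_actions (cstL L) (cstA X)
  (fun (l : L) (m : 'rV[Ltau L]_d) => skewC (frob (cstL L)) l *: m)
  (fun (a : affine X) (m : 'rV[Ltau L]_d) => m *m phi a).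
Proof.
split=> *.
- by move=> l l' /=; rewrite rmorphD scalerDl.
- by move=> m m'; rewrite scalerDr.
- by rewrite rmorph1 scale1r.
- by rewrite rmorphM scalerA.
- by move=> a a' /=; rewrite rmorphD mulmxDr.
- by move=> m m'; rewrite mulmxDl.
- by rewrite rmorph1 mulmx1.
- by rewrite mulrC rmorphM mulmxA.
- by rewrite scalemxAl.
- rewrite anderson_cst mul_row_scalar_central // => x.
  by apply: skewC_central => [|y]; [exact: frob_cst|rewrite mulrC].
Qed.

Lemma frobzN j (x : L) :
  frobz (cstL L) (- j%:Z) x = iter j (frobV (cstL L)) x.
Proof. by case: j. Qed.

Lemma skewcoef_adj (p : Ltau L) j :
  skewcoef (skewadj p) j = iter j (frobV (cstL L)) (skewcoef p j).
Proof.
rewrite /skewadj {1}/skewcoef coef_poly frobzN; case: ltnP => // h.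
rewrite /skewcoef nth_default //.
by elim: j {h} => // j IH; rewrite iterS -IH rmorph0.
Qed.

Let iterVD i : {morph iter i (frobV (cstL L)) : x y / x + y}.
Proof. by elim: i => // i IH x y; rewrite !iterS IH rmorphD. Qed.
Let iterVM i : {morph iter i (frobV (cstL L)) : x y / x * y}.
Proof. by elim: i => // i IH x y; rewrite !iterS IH rmorphM. Qed.
Let iterV0 i : iter i (frobV (cstL L)) 0 = 0.
Proof. by elim: i => // i IH; rewrite iterS IH rmorph0. Qed.
Let iterVK i j x : (i <= j)%N ->
  iter j (frobV (cstL L)) (iter i (frob (cstL L)) x)
    = iter (j - i) (frobV (cstL L)) x.
Proof.
elim: i j x => [|i IH] [|j] x //; rewrite subSS ltnS => ij.
by rewrite iterSr iterS frobK IH.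
Qed.

Lemma skewadjD : {morph @skewadj _ _ _ _ L : p q / p + q}.
Proof.
by move=> p q; apply/skewpolyP => n; rewrite !(skewcoef_adj, skewcoefD) iterVD.
Qed.

Lemma skewadj0 : skewadj (0 : Ltau L) = 0.
Proof. by apply: (addrI (skewadj 0)); rewrite -skewadjD !addr0. Qed.

Lemma skewadjC c : skewadj (skewC (frob (cstL L)) c) = skewC _ c.
Proof.
by apply/skewpolyP => -[|n]; rewrite skewcoef_adj !skewcoefC.
Qed.

Lemma skewadjM (p q : Ltau L) : skewadj (p * q) = skewadj q * skewadj p.
Proof.
apply/skewpolyP => n; rewrite skewcoef_adj !skewcoefM.
rewrite (big_morph _ (iterVD n) (iterV0 n)) [RHS](reindex_inj rev_ord_inj) /=.
apply: eq_bigr => i _; have i_n : (i <= n)%N by rewrite -ltnS.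
rewrite subSS !skewcoef_adj iterVM iterVK // subKn // -iterD subnK //.
by rewrite mulrC.
Qed.

Lemma adjmxM m n k (B : 'M[Ltau L]_(m, n)) (C : 'M[Ltau L]_(n, k)) :
  adjmx (B *m C) = adjmx C *m adjmx B.
Proof.
apply/matrixP => i j; rewrite !mxE (big_morph _ skewadjD skewadj0).
by apply: eq_bigr => l _; rewrite !mxE skewadjM.
Qed.

Lemma adjmxD m n : {morph @adjmx _ _ _ _ L m n : B C / B + C}.
Proof. by move=> B C; apply/matrixP => i j; rewrite !mxE skewadjD. Qed.

Lemma adjmx_scalar c n :
  adjmx ((skewC (frob (cstL L)) c)%:M : 'M[Ltau L]_n) = (skewC _ c)%:M.
Proof.
apply/matrixP => i j; rewrite !mxE eq_sym; case: eqP => _ /=.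
  by rewrite !mulr1n skewadjC.
by rewrite !mulr0n skewadj0.
Qed.

Fact dual_motive_actions : commuting_actions (cstL L) (cstA X)
  (fun (l : L) (n : 'rV[Lsigma L]_d) => skewC (frobV (cstL L)) l *: n)
  (fun (a : affine X) (n : 'rV[Lsigma L]_d) => n *m adjmx (phi a)).
Proof.
split=> *.
- by move=> l l' /=; rewrite rmorphD scalerDl.
- by move=> m m'; rewrite scalerDr.
- by rewrite rmorph1 scale1r.
- by rewrite rmorphM scalerA.
- by move=> a a' /=; rewrite rmorphD adjmxD mulmxDr.
- by move=> m m'; rewrite mulmxDl.
- have adj1 : adjmx (1%:M : 'M[Ltau L]_d) = 1%:M by exact: adjmx_scalar 1 d.
  by rewrite rmorph1 adj1 mulmx1.
- by rewrite rmorphM adjmxM mulmxA.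
- by rewrite scalemxAl.
- rewrite anderson_cst adjmx_scalar mul_row_scalar_central // => x.
  by apply: skewC_central => [|y]; [exact: frobV_cst|rewrite mulrC].
Qed.

End MotiveActions.

Section CommutativeAlgebra.
Variable T : idomainType.
Local Notation Q := {fraction T}.
Local Notation "x %:F" := (@FracField.tofrac T x).

Definition ideal_gen (S : set T) : set T :=
  [set x | exists2 s : seq (T * T), (forall p, p \in s -> S p.2)
         & x = \sum_(p <- s) p.1 * p.2].

Definition prime_ideal (P : set T) : Prop :=
  [/\ P 0, forall x y, P x -> P y -> P (x + y), forall t x, P x -> P (t * x),
      ~ P 1 & forall x y, P (x * y) -> P x \/ P y].

Definition fg_module (M : lmodType T) : Prop :=
  exists s : seq M, forall m, exists t : nat -> T,
    m = \sum_(k < size s) t k *: s`_k.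

Definition projective_module (M : lmodType T) : Prop :=
  forall (U V : lmodType T) (p : {linear U -> V}) (f : {linear M -> V}),
    (forall v, exists u, p u = v) ->
    exists g : {linear M -> U}, forall m, p (g m) = f m.

(* M_Q, i.e., the tensor product of M and Q = Frac(T) over T.                 *)
Record frac_module (M : lmodType T) := FracModule {
  frac_module_sort :> lmodType Q;
  frac_module_in : M -> frac_module_sort;
  frac_module_tensor : is_tensor_product
    (fun (t : T) (m : M) => t *: m) (fun (t : T) (f : Q) => t%:F * f)
    (fun m f => f *: frac_module_in m)
}.

(* The localizations S^-1 T and S^-1 M, as subsets of Q and M_Q (which is     *)
(* what they are up to canonical isomorphism, for M torsion-free).            *)
Definition loc_ring (S : set T) : set Q :=
  [set f | exists x s, S s /\ f = x%:F / s%:F].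

Definition loc_module (M : lmodType T) (MQ : frac_module M) (S : set T) :
    set MQ :=
  [set y | exists m s, S s /\ y = (s%:F)^-1 *: frac_module_in MQ m].

Arguments loc_module {M} MQ S _.

(* e is a basis of the module Y over the subring S of E.                      *)
Definition is_basis (E : fieldType) (V : lmodType E) (S : set E) (Y : set V)
    (r : nat) (e : 'I_r -> V) : Prop :=
  (forall k, Y (e k)) /\
  forall y, Y y -> exists! c : 'rV[E]_r,
    (forall k, S (c 0 k)) /\ y = \sum_k c 0 k *: e k.

Definition constant_rank (M : lmodType T) (MQ : frac_module M) (r : nat) :
    Prop :=
  forall P, prime_ideal P -> exists e : 'I_r -> MQ,
    is_basis (loc_ring (~` P)) (loc_module MQ (~` P)) e.

End CommutativeAlgebra.

Arguments loc_module {T M} MQ S _.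

(* The product I Y of an ideal and a submodule; iter n (ideal_mul I) Y is     *)
(* I^n Y.                                                                     *)
Definition ideal_mul (E : pzRingType) (V : lmodType E) (I : set E) (Y : set V) :
    set V :=
  [set v | exists2 s : seq (E * V), (forall p, p \in s -> I p.1 /\ Y p.2)
         & v = \sum_(p <- s) p.1 *: p.2].

Section Motives.
Variables (R : realType) (F : finFieldType) (X : curve F).
Variables (I : infty_fields R X) (L : coeff_field I) (LA : tensorLA L).
Local Notation Q := {fraction LA}.
Local Notation "x %:F" := (@FracField.tofrac LA x).

Definition twist (i : int) : LA -> LA :=
  tensor_lift (fun l a => LA_L LA l * LA_A LA a)
              (fun l a => LA_L LA (frobz (cstL L) i l) * LA_A LA a).

Definition twistQ (i : int) (f : Q) : Q :=
  (twist i \n_(repr f))%:F / (twist i \d_(repr f))%:F.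

Definition Jideal (i : int) : set LA :=
  ideal_gen [set x | exists a : affine X,
    x = LA_A LA a - LA_L LA (frobz (cstL L) i (A_L L a))].

Definition regular_at_Xi (i : int) : set Q := loc_ring (~` Jideal i).

Definition A_nonzero : set LA := [set x | exists2 a, a != 0 & x = LA_A LA a].

(* L (x) K inside Q.                                                          *)
Definition LK : set Q := loc_ring A_nonzero.

Variables (d : nat) (phi : anderson L d).

Definition motive := tensor_module (LA_tensor LA) (motive_actions phi).
HB.instance Definition _ := GRing.Lmodule.on motive.

Definition dual_motive := tensor_module (LA_tensor LA) (dual_motive_actions phi).
HB.instance Definition _ := GRing.Lmodule.on dual_motive.

Definition motive_tau (m : motive) : motive := tau L *: (m : 'rV[Ltau L]_d).
Definition motive_gen (k : 'I_d) : motive := delta_mx 0 k : 'rV[Ltau L]_d.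

Definition dual_sigma (n : dual_motive) : dual_motive :=
  sigma L *: (n : 'rV[Lsigma L]_d).
Definition dual_gen (k : 'I_d) : dual_motive := delta_mx 0 k : 'rV[Lsigma L]_d.

Definition deltaM (z : 'cV[L]_d) (m : motive) : L :=
  \sum_k tau_eval ((m : 'rV[Ltau L]_d) 0 k) (z k 0).

Definition deltaN (n : dual_motive) : 'cV[L]_d :=
  \col_k skewcoef ((n : 'rV[Lsigma L]_d) 0 k) 0.

Definition Jpow_sub_sigma (n : nat) : Prop :=
  iter n (ideal_mul (Jideal 0)) [set: dual_motive] `<=` range dual_sigma.

Variables (MQ : frac_module motive) (NQ : frac_module dual_motive).

Definition abelian_motive (r : nat) : Prop :=
  [/\ fg_module motive, projective_module motive, constant_rank MQ r
    & exists n0, forall n, (n0 <= n)%N ->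
        iter n (ideal_mul (Jideal 0)) [set: motive] `<=` range motive_tau].

Definition A_finite_dual_motive (r : nat) : Prop :=
  [/\ fg_module dual_motive, projective_module dual_motive,
      constant_rank NQ r
    & exists n0, forall n, (n0 <= n)%N -> Jpow_sub_sigma n].

Definition tauQ : MQ -> MQ :=
  tensor_lift (fun m f => f *: frac_module_in MQ m)
              (fun m f => twistQ 1 f *: frac_module_in MQ (motive_tau m)).

Definition sigmaQ : NQ -> NQ :=
  tensor_lift (fun n f => f *: frac_module_in NQ n)
              (fun n f => twistQ (-1) f *: frac_module_in NQ (dual_sigma n)).

(* The inverse of sigmaQ, which is a bijection for A-finite dual motives.     *)
Definition sigmaQV (y : NQ) : NQ := xget 0 [set x | sigmaQ x = y].

(* M (x)_A K and N (x)_A K are localizations at A \ {0}.                      *)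
Definition Xi_regular (r : nat) : Prop :=
  exists (c : 'I_r -> MQ) (e : 'I_r -> NQ) (Phi : 'M[Q]_r),
  [/\ is_basis LK (loc_module MQ A_nonzero) c,
      is_basis LK (loc_module NQ A_nonzero) e,
      forall k l, LK (Phi k l),
      (forall k, tauQ (c k) = \sum_l Phi k l *: c l) /\
      (forall k, sigmaQ (e k) = \sum_l Phi l k *: e l)
    & forall i : int, regular_at_Xi i (\det Phi) /\
        forall k l, regular_at_Xi i (Phi k l)].

Definition NJ : set NQ := loc_module NQ (~` Jideal 0).

(* The extension of deltaN to N_J: deltaN n for any n in N congruent to x     *)
(* modulo J^m N_J, where J^m N is a subset of sigma N.                        *)
Definition deltaNJ (x : NQ) : 'cV[L]_d :=
  deltaN (xget 0 [set n | exists2 m, Jpow_sub_sigma m &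
    iter m (ideal_mul (@FracField.tofrac LA @` Jideal 0)) NJ
      (x - frac_module_in NQ n)]).

Definition G_term (z : 'cV[L]_d) (i : nat) : 'cV[L]_d :=
  \sum_k deltaNJ ((LA_L LA (deltaM z (iter i motive_tau (motive_gen k))))%:F
    *: iter i sigmaQV (frac_module_in NQ (dual_gen k))).

End Motives.

Section Logarithm.
Variables (R : realType) (F : finFieldType) (X : curve F).
Variables (I : infty_fields R X) (L : coeff_field I) (d : nat).
Local Notation C := (Cinf I).

Definition vseries_cvg (u : nat -> 'cV[C]_d) (w : 'cV[C]_d) : Prop :=
  forall k, abs_cvg (Cinf_abs I) (fun n => (\sum_(0 <= i < n) u i) k 0) (w k 0).

(* P is the sequence of coefficients of Log_phi: the condition compares the   *)
(* coefficients of z^(n) in Log_phi(phi_a(z)) and d[a] Log_phi(z).            *)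
Definition is_log (phi : anderson L d) (P : nat -> 'M[C]_d) : Prop :=
  P 0%N = 1%:M /\
  forall (a : affine X) (n : nat),
    \sum_(j < n.+1) P (n - j)%N *m
      map_mx (fun x => L_C L x ^+ (#|F| ^ (n - j))) (coefmx j (phi a))
    = map_mx (L_C L) (coefmx 0 (phi a)) *m P n.

Definition log_term (P : nat -> 'M[C]_d) (z : 'cV[C]_d) (i : nat) : 'cV[C]_d :=
  P i *m map_mx (fun x => x ^+ (#|F| ^ i)) z.

Definition log_domain (P : nat -> 'M[C]_d) : set 'cV[C]_d :=
  [set z | exists w, vseries_cvg (log_term P z) w].

Definition Log (P : nat -> 'M[C]_d) (z : 'cV[C]_d) : 'cV[C]_d :=
  xget 0 [set w | vseries_cvg (log_term P z) w].

End Logarithm.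

(* Main.v *)
Require Import Defs.
From HB Require Import structures.
From mathcomp Require Import all_boot all_order all_algebra.
From mathcomp Require Import boolp classical_sets reals topology normedtype.

(* The series is the logarithm term by term: let P'_i be the matrix with     *)
(* columns delta_0(sigma^-i h_k), so that the i-th term of G is P'_i z^(i).  *)
(* Applying delta_0 sigma^-i to a h_k = \sum_(j, l) c_(j, l) sigma^j h_l,    *)
(* where the c_(j, l) are the coefficients of phi_a^*, and using that        *)
(* delta_0 kills sigma N and turns a into d[a], one gets                     *)
(*   d[a] P'_i = \sum_(j <= i) P'_(i - j) A_(a, j)^(i - j),                  *)
(* the recursion defining the coefficients of Log_phi. It has at most one    *)
(* solution with P'_0 = 1, because d[a] and d[a]^(i) have no common          *)
(* eigenvalue when a is not constant; a nonconstant a exists since N is      *)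
(* finitely generated over L (x) A. With w = 1 (x) a - a (x) 1 and           *)
(* J^n N contained in sigma N, sigma^-1 only introduces the denominator      *)
(* (w^(1))^n, which is prime to J and remains so after further twists; hence *)
(* all sigma^-i h_k lie in N_J.                                              *)

Set Implicit Arguments.
Unset Strict Implicit.
Unset Printing Implicit Defensive.

Import GRing.Theory.

Local Open Scope classical_set_scope.
Local Open Scope ring_scope.

(** The equality holds term by term, so convergence is inherited from the logarithm. [G_termE]
    writes the i-th term of G as P'_i z^(i), where P'_i = [log_mx i] is built from the
    delta_0(sigma^-i h_k) alone. Expanding a h_k in powers of sigma ([deltaNJ_iter_sigmaQV]) and
    using delta_0(a x) = d[a] delta_0(x) yields the functional equation of Log_phi coefficient by
    coefficient ([log_mx_rec]). [is_log_unique] then gives P'_i = P_i, through a Sylvester equation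
    whose matrices have the single, distinct eigenvalues a and a^(q^i).

    The rest gives a meaning to delta_0 sigma^-i. J is the kernel of evaluation at Xi ([JidealP]),
    so an element outside J is invertible modulo powers of J, and delta_0 extends to N_J
    ([deltaNJ_eq]). The sigma^-i h_k stay in [sigma_dom], a submodule of N_J stable under sigma^-1
    ([sigmaQV_dom]). This stability and the uniqueness both rest on one nonconstant a
    ([exists_nonconstant]). *)

(** * Induction on tensors *)

Section TensorInduction.
Variables (R : Type) (U V W : zmodType).
Variables (aU : R -> U -> U) (aV : R -> V -> V) (t : U -> V -> W).
Hypothesis tP : is_tensor_product aU aV t.

(** The subgroup as a group in its own right, so that it can be the target in the universal
    property. *)
Record subgroup_type (S : zmodClosed W) :=
  Subgroup { subgroup_val :> W; subgroup_valP : subgroup_val \in S }.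

HB.instance Definition _ S := [isSub for @subgroup_val S].
HB.instance Definition _ S := [Choice of subgroup_type S by <:].
HB.instance Definition _ S :=
  [SubChoice_isSubZmodule of subgroup_type S by <:].

(* The universal property gives a retraction of W onto any subgroup that     *)
(* contains the pure tensors.                                                *)
Let tensor_mem (S : zmodClosed W) : (forall u v, t u v \in S) ->
  forall w, w \in S.
Proof.
move=> tS w; have [tl tr tb] := tP.1.
have fP : balanced aU aV (fun u v => Subgroup (tS u v)).
  by split=> *; apply: val_inj; rewrite /= ?raddfD /= ?tl ?tr ?tb.
have [gD gt] := tensor_liftP tP fP.
set g := tensor_lift _ _ in gD gt.
have gw : w = val (g w).
  apply: (tensor_eq tP (g := id) (h := fun x => val (g x))) => //.
  - by move=> x y; rewrite gD raddfD.
  - by move=> u v; rewrite gt.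
by rewrite gw; exact: valP.
Qed.

(** Replaces writing an element as a sum of pure tensors, which the universal property does not
    provide directly. *)
Lemma tensor_ind (P : W -> Prop) : P 0 ->
  (forall x y, P x -> P y -> P (x - y)) -> (forall u v, P (t u v)) ->
  forall w, P w.
Proof.
move=> P0 PB Pt w.
pose S : {pred W} := fun x => `[< P x >].
have Sz : zmod_closed S.
  split=> [|x y /asboolP Px /asboolP Py]; first exact/asboolP.
  by apply/asboolP; exact: PB.
pose Sc := GRing.isZmodClosed.Build W S Sz.
pose SS : zmodClosed W := HB.pack S Sc.
by apply/asboolP; apply: (tensor_mem (S := SS)) => u v; exact/asboolP.
Qed.

End TensorInduction.

(** The relation gives D (B - a)^k = (A - a)^k D = 0. The factors B - a can be cancelled on the
    right: if C (B - a) = 0, then (a - b)^m C = C (B - b)^m = 0. *)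
Lemma sylvester_eq0 (E : fieldType) (d : nat) (a b : E) (A B D : 'M[E]_d)
    (k m : nat) : a != b -> (A - a%:M) ^+ k = 0 -> (B - b%:M) ^+ m = 0 ->
  D *m B = A *m D -> D = 0.
Proof.
move=> ab Ak Bm DB.
have cancel_shift (C : 'M[E]_d) : C *m (B - a%:M) = 0 -> C = 0.
  move=> CB; have CBb j : C *m (B - b%:M) ^+ j = (a - b) ^+ j *: C.
    elim: j => [|j IH]; first by rewrite !expr0 scale1r mulmx1.
    have -> : B - b%:M = (B - a%:M) + (a - b)%:M.
      by rewrite raddfB /= addrA subrK.
    rewrite exprS mulmxA mulmxDr CB add0r mul_mx_scalar -scalemxAl.
    have -> : (B - a%:M) + (a - b)%:M = B - b%:M.
      by rewrite raddfB /= addrA subrK.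
    by rewrite IH scalerA exprS.
  have /eqP := CBb m; rewrite Bm mulmx0 eq_sym scaler_eq0 expf_eq0 subr_eq0.
  by rewrite (negPf ab) andbF => /eqP.
have shift j : D *m (B - a%:M) ^+ j = (A - a%:M) ^+ j *m D.
  elim: j => [|j IH]; first by rewrite !expr0 mulmx1 mul1mx.
  rewrite exprSr mulmxA IH -mulmxA mulmxBr DB mul_mx_scalar -mul_scalar_mx.
  by rewrite -mulmxBl mulmxA; congr (_ *m _); rewrite exprSr.
have: D *m (B - a%:M) ^+ k = 0 by rewrite shift Ak mul0mx.
elim: k {Ak} => [|k IH]; first by rewrite expr0 mulmx1.
by rewrite exprSr mulmxA => /cancel_shift.
Qed.

(** * Extending an injective endomorphism of a domain to its fraction field *)

Section Fractions.
Variable T : idomainType.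
Local Notation "x %:F" := (@FracField.tofrac T x).

Lemma frac_repr (f : {fraction T}) :
  f = (\n_(repr f))%:F / (\d_(repr f))%:F.
Proof.
have d0 := denom_ratioP (repr f).
apply: (mulIf (x := (\d_(repr f))%:F)); first by rewrite tofrac_eq0.
rewrite divfK ?tofrac_eq0 // -{1}[f]reprK; unlock FracField.tofrac.
rewrite -[LHS]FracField.pi_mul; apply/eqmodP => /=.
rewrite FracField.equivfE /FracField.mulf.
by rewrite !numden_Ratio ?mulf_neq0 ?oner_neq0 // !mulr1 mulrC.
Qed.

Variable g : {rmorphism T -> T}.
Hypothesis g_inj : injective g.

(** The formula of [twistQ] for a general endomorphism; injectivity keeps denominators nonzero and
    makes the choice of representative harmless. *)
Definition frac_map (f : {fraction T}) : {fraction T} :=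
  (g \n_(repr f))%:F / (g \d_(repr f))%:F.

Let gF_neq0 y : y != 0 -> (g y)%:F != 0.
Proof. by move=> y0; rewrite tofrac_eq0 raddf_eq0. Qed.

Lemma frac_map_div x y : y != 0 ->
  frac_map (x%:F / y%:F) = (g x)%:F / (g y)%:F.
Proof.
move=> y0; rewrite /frac_map.
set f := x%:F / y%:F; have := frac_repr f; rewrite {1}/f.
have := denom_ratioP (repr f); move: (\n_(repr f)) (\d_(repr f)) => n d d0.
move/eqP; rewrite eqr_div ?tofrac_eq0 // -!rmorphM tofrac_eq => /eqP xd.
by apply/eqP; rewrite eqr_div ?gF_neq0 // -!rmorphM tofrac_eq xd.
Qed.

Lemma frac_map_tofrac x : frac_map x%:F = (g x)%:F.
Proof.
by have := frac_map_div x (oner_neq0 T); rewrite !rmorph1 !divr1.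
Qed.

Lemma frac_mapV x : frac_map x%:F^-1 = (g x)%:F^-1.
Proof.
have [->|x0] := eqVneq x 0; last first.
  by have := frac_map_div 1 x0; rewrite !rmorph1 !div1r.
by rewrite !rmorph0 !invr0 -(rmorph0 (@FracField.tofrac T)) frac_map_tofrac
  rmorph0.
Qed.

Lemma frac_mapD : {morph frac_map : a b / a + b}.
Proof.
move=> a b; rewrite [a]frac_repr [b]frac_repr.
move: (denom_ratioP (repr a)) (denom_ratioP (repr b)).
move: (\n_(repr a)) (\d_(repr a)) (\n_(repr b)) (\d_(repr b)) => x y z t y0 t0.
rewrite addf_div ?tofrac_eq0 // -!rmorphM -rmorphD !frac_map_div ?mulf_neq0 //.
by rewrite addf_div ?gF_neq0 // -!rmorphM -rmorphD /= !rmorphD !rmorphM.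
Qed.

Lemma frac_mapM : {morph frac_map : a b / a * b}.
Proof.
move=> a b; rewrite [a]frac_repr [b]frac_repr.
move: (denom_ratioP (repr a)) (denom_ratioP (repr b)).
move: (\n_(repr a)) (\d_(repr a)) (\n_(repr b)) (\d_(repr b)) => x y z t y0 t0.
rewrite mulf_div -!rmorphM !frac_map_div ?mulf_neq0 //.
by rewrite mulf_div -!rmorphM.
Qed.

End Fractions.

(** * Submodules, powers of ideals, and localizations inside M_Q *)

Definition submodule_set (E : pzRingType) (V : lmodType E) (Y : set V) : Prop :=
  [/\ Y 0, forall x y, Y x -> Y y -> Y (x + y) & forall t x, Y x -> Y (t *: x)].

Lemma ideal_mul_submodule (E : comPzRingType) (V : lmodType E) (I : set E)
    (Y : set V) : submodule_set Y -> submodule_set (ideal_mul I Y).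
Proof.
move=> [Y0 YD YZ]; split.
- by exists [::]; rewrite ?big_nil.
- move=> _ _ [s sP ->] [s' s'P ->]; exists (s ++ s'); last by rewrite big_cat.
  by move=> p; rewrite mem_cat => /orP[/sP|/s'P].
- move=> t _ [s sP ->]; exists [seq (p.1, t *: p.2) | p <- s].
    by move=> _ /mapP[p /sP[Ip Yp] ->]; split=> //=; exact: YZ.
  rewrite big_map scaler_sumr; apply: eq_bigr => p _ /=.
  by rewrite !scalerA mulrC.
Qed.

Lemma iter_ideal_mul_submodule (E : comPzRingType) (V : lmodType E)
    (I : set E) (n : nat) : submodule_set (iter n (ideal_mul I) [set: V]).
Proof. by elim: n => [|n IH]; [split|exact: ideal_mul_submodule]. Qed.

Lemma iter_ideal_mul_exp (E : pzRingType) (V : lmodType E) (I : set E)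
    (Y : set V) w y n : I w -> Y y -> iter n (ideal_mul I) Y (w ^+ n *: y).
Proof.
move=> Iw Yy; elim: n => [|n IH]; first by rewrite scale1r.
exists [:: (w, w ^+ n *: y)]; last by rewrite big_seq1 exprS scalerA.
by move=> p; rewrite inE => /eqP ->.
Qed.

Section FractionModule.
Variables (T : idomainType) (M : lmodType T) (MQ : frac_module M).
Local Notation "x %:F" := (@FracField.tofrac T x).
Local Notation inM := (frac_module_in MQ).

Let tP := frac_module_tensor MQ.

Lemma frac_inD : {morph inM : x y / x + y}.
Proof.
by move=> x y; have [h _ _] := tP.1; have := h x y 1; rewrite !scale1r.
Qed.

Lemma frac_inZ t x : inM (t *: x) = t%:F *: inM x.
Proof.
by have [_ _ h] := tP.1; have := h t x 1; rewrite scale1r mulr1.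
Qed.

Lemma frac_in0 : inM 0 = 0.
Proof. by rewrite -(scale0r (0 : M)) frac_inZ rmorph0 scale0r. Qed.

Lemma frac_inN x : inM (- x) = - inM x.
Proof. by rewrite -scaleN1r frac_inZ rmorphN rmorph1 scaleN1r. Qed.

Lemma frac_inB x y : inM (x - y) = inM x - inM y.
Proof. by rewrite frac_inD frac_inN. Qed.

Lemma frac_in_sum (J : Type) (r : seq J) (G : J -> M) :
  inM (\sum_(j <- r) G j) = \sum_(j <- r) inM (G j).
Proof. exact: (big_morph _ frac_inD frac_in0). Qed.

(** The localization S^-1 Y inside M_Q. It is used for Y = M, J^n M and sigma N. *)
Definition loc_sub (Y : set M) (S : set T) : set MQ :=
  [set y | exists m s, [/\ Y m, S s & y = s%:F^-1 *: inM m]].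

Definition mult_set (S : set T) : Prop :=
  [/\ S 1, forall s, S s -> s != 0 & forall s t, S s -> S t -> S (s * t)].

Lemma loc_sub_submodule (Y : set M) (S : set T) :
  submodule_set Y -> mult_set S ->
  [/\ loc_sub Y S 0, forall x y, loc_sub Y S x -> loc_sub Y S y ->
        loc_sub Y S (x + y) & forall t x, loc_sub Y S x ->
        loc_sub Y S (t%:F *: x)].
Proof.
move=> [Y0 YD YZ] [S1 S0 SM]; split.
- by exists 0, 1; split=> //; rewrite frac_in0 scaler0.
- move=> _ _ [m [s [Ym Ss ->]]] [m' [s' [Ym' Ss' ->]]].
  exists (s' *: m + s *: m'), (s * s'); split; [|exact: SM|].
    by apply: YD; exact: YZ.
  have sF := S0 _ Ss; have s'F := S0 _ Ss'.
  rewrite frac_inD !frac_inZ scalerDr !scalerA rmorphM invfM.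
  by rewrite mulfVK ?tofrac_eq0 // mulrAC mulVf ?tofrac_eq0 // mul1r.
- move=> t _ [m [s [Ym Ss ->]]]; exists (t *: m), s; split=> //.
    exact: YZ.
  by rewrite frac_inZ !scalerA mulrC.
Qed.

(** A finite sum of fractions has a common denominator, so powers of I can be taken before
    localizing. *)
Lemma iter_ideal_mul_loc (I : set T) (S : set T) (n : nat) : mult_set S ->
  iter n (ideal_mul (@FracField.tofrac T @` I)) (loc_module MQ S)
    `<=` loc_sub (iter n (ideal_mul I) [set: M]) S.
Proof.
move=> Sm; elim: n => [|n IH].
  by move=> _ [m [s [Ss ->]]]; exists m, s.
have [l0 lD lZ] := loc_sub_submodule
  (iter_ideal_mul_submodule M I n.+1) Sm.
move=> _ [r rP ->]; elim: r rP => [|[f y] r IHr] rP; first by rewrite big_nil.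
rewrite big_cons; apply: lD; last first.
  by apply: IHr => p pr; apply: rP; rewrite inE pr orbT.
have [/= [j Ij <-] /IH[m [s [Ym Ss ->]]]] := rP _ (mem_head _ _).
exists (j *: m), s; split=> //.
  by exists [:: (j, m)]; rewrite ?big_seq1 // => p; rewrite inE => /eqP ->.
by rewrite frac_inZ !scalerA mulrC.
Qed.

Lemma frac_module_den (y : MQ) :
  exists m s, s != 0 /\ y = s%:F^-1 *: inM m.
Proof.
have Sm : mult_set [set s : T | s != 0].
  by split=> //= [|s t]; [exact: oner_neq0|exact: mulf_neq0].
have Tm : submodule_set [set: M] by split.
have [l0 lD lZ] := loc_sub_submodule Tm Sm.
suff: loc_sub [set: M] [set s : T | s != 0] y.
  by move=> [m [s [_ s0 ->]]]; exists m, s.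
move: y; apply: (tensor_ind tP) => // [x y lx ly|m f].
  apply: lD => //.
  by rewrite -scaleN1r -(rmorph1 (@FracField.tofrac T)) -rmorphN; exact: lZ.
exists (\n_(repr f) *: m), (\d_(repr f)); split=> //=.
  exact: denom_ratioP.
by rewrite frac_inZ scalerA mulrC -frac_repr.
Qed.

(* A nonzero element of a finitely generated projective module is detected   *)
(* by a linear functional, which extends to the fractions.                    *)
Lemma frac_in_inj : fg_module M -> projective_module M -> injective inM.
Proof.
move=> [s sP] prM.
pose p (v : 'rV[T]_(size s)) : M := \sum_(k < size s) v 0 k *: s`_k.
have p_lin : linear p.
  move=> a u v; rewrite /p scaler_sumr -big_split; apply: eq_bigr => k _.
  by rewrite !mxE scalerDl scalerA.
pose pL : {linear 'rV[T]_(size s) -> M} :=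
  HB.pack p (GRing.isLinear.Build _ _ _ _ p p_lin).
have p_surj m : exists v, pL v = m.
  have [t ->] := sP m; exists (\row_k t k) => /=.
  by apply: eq_bigr => k _; rewrite mxE.
have [g gP] := prM _ _ pL idfun p_surj.
suff in0 m : inM m = 0 -> m = 0.
  by move=> m m' mm'; apply/subr0_eq/in0; rewrite frac_inB mm' subrr.
move=> m0; have gm0 : g m = 0.
  apply/rowP => k; rewrite [RHS]mxE.
  have fP : balanced (fun (t : T) (m : M) => t *: m)
      (fun (t : T) (f : {fraction T}) => t%:F * f)
      (fun n f => (g n 0 k)%:F * f).
    split=> [n n' f|n f f'|t n f]; last 1 first.
    - by rewrite linearZ mxE rmorphM /= mulrCA mulrA.
    - by rewrite raddfD mxE rmorphD mulrDl.
    - by rewrite mulrDr.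
  have [hD hP] := tensor_liftP tP fP.
  have := hP m 1; rewrite scale1r m0 mulr1.
  set h := tensor_lift _ _ in hD *.
  have -> : h 0 = 0 by apply: (addrI (h 0)); rewrite -hD !addr0.
  by move/esym/eqP; rewrite tofrac_eq0 => /eqP.
by rewrite -[m]gP gm0 raddf0.
Qed.

End FractionModule.

(** * Ring morphisms out of a tensor product of commutative rings *)

Section TensorMorphism.
Variables (F : Type) (L A T E : comNzRingType).
Variables (iL : {rmorphism L -> T}) (iA : {rmorphism A -> T}).
Variables (fL : F -> L) (fA : F -> A).
Hypothesis tP : is_tensor_product (fun c l => fL c * l) (fun c a => fA c * a)
  (fun l a => iL l * iA a).
Variables (u : {rmorphism L -> E}) (v : {rmorphism A -> E}).
Hypothesis uv : forall c, u (fL c) = v (fA c).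

Local Notation lift :=
  (tensor_lift (fun l a => iL l * iA a) (fun l a => u l * v a)).

Let bal : balanced (fun c l => fL c * l) (fun c a => fA c * a)
  (fun l a => u l * v a).
Proof.
split=> [l l' a|l a a'|c l a]; rewrite ?rmorphD ?mulrDl ?mulrDr //.
by rewrite !rmorphM uv mulrAC mulrC.
Qed.

Lemma tensor_lift_pure l a : lift (iL l * iA a) = u l * v a.
Proof. exact: (tensor_liftP tP bal).2. Qed.

Let liftD : {morph lift : x y / x + y}.
Proof. exact: (tensor_liftP tP bal).1. Qed.

Lemma tensor_lift_zmod_morphism : zmod_morphism lift.
Proof.
move=> x y; have -> : - y = -1 * y by rewrite mulN1r.
suff -> : lift x = lift (x - y) + lift y by rewrite mulN1r addrK.
by rewrite -liftD subrK.
Qed.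

Lemma tensor_lift_monoid_morphism : monoid_morphism lift.
Proof.
split; first by rewrite -[X in lift X]mul1r -{1}(rmorph1 iL) -(rmorph1 iA)
  tensor_lift_pure !rmorph1 mulr1.
move=> x y; move: x; apply: (tensor_eq tP (g := fun x => lift (x * y))
  (h := fun x => lift x * lift y)) => [x x'|x x'|l a].
- by rewrite mulrDl liftD.
- by rewrite liftD mulrDl.
move: y; apply: (tensor_eq tP (g := fun y => lift (iL l * iA a * y))
  (h := fun y => lift (iL l * iA a) * lift y)) => [y y'|y y'|l' a'].
- by rewrite mulrDr liftD.
- by rewrite liftD mulrDr.
by rewrite mulrACA -!rmorphM !tensor_lift_pure !rmorphM mulrACA.
Qed.

End TensorMorphism.

(** * Iterates of Frobenius and of its inverse *)

Section IteratedFrobenius.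
Variables (F : finFieldType) (L : closedFieldType) (i : {rmorphism F -> L}).

Lemma frob_iterE n x : iter n (frob i) x = x ^+ (#|F| ^ n).
Proof.
by elim: n => [|n IH]; rewrite ?expr1 // iterS IH /frob -exprM expnSr.
Qed.

Let iter_zmod_morphism (f : {rmorphism L -> L}) n : zmod_morphism (iter n f).
Proof. by move=> x y; elim: n => //= n ->; rewrite rmorphB. Qed.

Let iter_monoid_morphism (f : {rmorphism L -> L}) n :
  monoid_morphism (iter n f).
Proof.
by split=> [|x y]; elim: n => //= n ->; rewrite ?rmorph1 ?rmorphM.
Qed.

Fact frobz_is_zmod_morphism n : zmod_morphism (frobz i n).
Proof.
case: n => n; first exact: (iter_zmod_morphism (frob i) n).
exact: (iter_zmod_morphism (frobV i) n.+1).
Qed.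

Fact frobz_is_monoid_morphism n : monoid_morphism (frobz i n).
Proof.
case: n => n; first exact: (iter_monoid_morphism (frob i) n).
exact: (iter_monoid_morphism (frobV i) n.+1).
Qed.

HB.instance Definition _ n :=
  GRing.isZmodMorphism.Build L L (frobz i n) (frobz_is_zmod_morphism n).
HB.instance Definition _ n :=
  GRing.isMonoidMorphism.Build L L (frobz i n) (frobz_is_monoid_morphism n).

Lemma frobz_cst n (c : F) : frobz i n (i c) = i c.
Proof.
by case: n => n; apply: iter_fix; rewrite ?frob_cst ?frobV_cst.
Qed.

End IteratedFrobenius.

(** * Twists of L (x) A and evaluation at Xi *)

Section Twist.
Variables (R : realType) (F : finFieldType) (X : curve F).
Variables (I : infty_fields R X) (L : coeff_field I) (LA : tensorLA L).
Local Notation inL := (LA_L LA).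
Local Notation inA := (LA_A LA).

Lemma LA_cst c : inL (cstL L c) = inA (cstA X c).
Proof.
have [_ _ h] := (LA_tensor LA).1.
by have := h c 1 1; rewrite !rmorph1 !mulr1 mul1r.
Qed.

Let twist_cst i c : (inL \o frobz (cstL L) i) (cstL L c) = inA (cstA X c).
Proof. by rewrite /= frobz_cst LA_cst. Qed.

HB.instance Definition _ i :=
  GRing.isZmodMorphism.Build LA LA (@twist _ _ _ _ _ LA i)
    (tensor_lift_zmod_morphism (LA_tensor LA) (twist_cst i)).
HB.instance Definition _ i :=
  GRing.isMonoidMorphism.Build LA LA (@twist _ _ _ _ _ LA i)
    (tensor_lift_monoid_morphism (LA_tensor LA) (twist_cst i)).

Lemma twist_pure i l a :
  twist i (inL l * inA a) = inL (frobz (cstL L) i l) * inA a.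
Proof. exact: (tensor_lift_pure (LA_tensor LA) (twist_cst i)). Qed.

Lemma twistL i l : twist i (inL l) = inL (frobz (cstL L) i l).
Proof. by have := twist_pure i l 1; rewrite !rmorph1 !mulr1. Qed.

Lemma twistA i a : twist i (inA a) = inA a.
Proof. by have := twist_pure i 1 a; rewrite !rmorph1 !mul1r. Qed.

Lemma twist1K : cancel (@twist _ _ _ _ _ LA 1) (twist (-1)).
Proof.
apply: (tensor_eq (LA_tensor LA)) => // [x y|l a]; first by rewrite !rmorphD.
by rewrite !twist_pure /= frobK.
Qed.

Lemma twistN1K : cancel (@twist _ _ _ _ _ LA (-1)) (twist 1).
Proof.
apply: (tensor_eq (LA_tensor LA)) => // [x y|l a]; first by rewrite !rmorphD.
by rewrite !twist_pure /= frobVK.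
Qed.

(** The multiplication map sending l (x) a to l a, that is, evaluation at the point Xi. *)
Definition Xi_eval : LA -> L :=
  tensor_lift (fun l a => inL l * inA a)
    (fun l a => (idfun : L -> L) l * (K_L L \o val) (a : affine X)).

Let Xi_cst c : (idfun : L -> L) (cstL L c) = (K_L L \o val) (cstA X c).
Proof. by []. Qed.

HB.instance Definition _ := GRing.isZmodMorphism.Build LA L Xi_eval
  (tensor_lift_zmod_morphism (LA_tensor LA) Xi_cst).
HB.instance Definition _ := GRing.isMonoidMorphism.Build LA L Xi_eval
  (tensor_lift_monoid_morphism (LA_tensor LA) Xi_cst).

Lemma Xi_eval_pure l a : Xi_eval (inL l * inA a) = l * A_L L a.
Proof. exact: (tensor_lift_pure (LA_tensor LA) Xi_cst). Qed.

Lemma Xi_evalL l : Xi_eval (inL l) = l.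
Proof. by have := Xi_eval_pure l 1; rewrite /A_L !rmorph1 !mulr1. Qed.

Lemma Xi_evalA a : Xi_eval (inA a) = A_L L a.
Proof. by have := Xi_eval_pure 1 a; rewrite rmorph1 !mul1r. Qed.

Lemma ideal_genZ (T : idomainType) (S : set T) t x :
  S x -> ideal_gen S (t * x).
Proof.
move=> Sx; exists [:: (t, x)]; last by rewrite big_seq1.
by move=> p; rewrite inE => /eqP ->.
Qed.

(** Modulo J, 1 (x) a equals a (x) 1, so x is congruent to [Xi_eval x] (x) 1. On a pure tensor the
    difference is l (x) 1 times a generator of J. *)
Lemma JidealP x : @Jideal _ _ _ _ _ LA 0 x <-> Xi_eval x = 0.
Proof.
split=> [[s sP ->]|x0].
  rewrite rmorph_sum big1_seq // => p /andP[_ /sP[a ->]] /=.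
  by rewrite rmorphM rmorphB /= Xi_evalA Xi_evalL subrr mulr0.
have -> : x = x - inL (Xi_eval x) by rewrite x0 rmorph0 subr0.
move: {x0} x; apply: (tensor_ind (LA_tensor LA)) => [|x y Jx Jy|l a].
- by rewrite !rmorph0 subr0; exists [::]; rewrite ?big_nil.
- have -> : x - y - inL (Xi_eval (x - y))
      = x - inL (Xi_eval x) - (y - inL (Xi_eval y)).
    by rewrite !rmorphB !opprD !opprK addrACA.
  case: Jx Jy => [s sP ->] [s' s'P ->].
  exists (s ++ [seq (- p.1, p.2) | p <- s']).
    by move=> p; rewrite mem_cat => /orP[/sP //|/mapP[p' /s'P h ->]].
  rewrite big_cat big_map -sumrN /=; congr (_ + _).
  by apply: eq_bigr => p _; rewrite mulNr.
- rewrite Xi_eval_pure rmorphM -mulrBr; apply: ideal_genZ.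
  by exists a.
Qed.

Lemma mult_set_NJ : mult_set (~` @Jideal _ _ _ _ _ LA 0).
Proof.
split=> [/JidealP/eqP|s|s t].
- by rewrite rmorph1 oner_eq0.
- by apply: contra_notN => /eqP ->; apply/JidealP; rewrite rmorph0.
- move=> Js Jt /JidealP/eqP; rewrite rmorphM mulf_eq0 => /orP[]/eqP/JidealP //.
Qed.

End Twist.

(** * Coefficients in sigma on the dual motive N *)

Section DualMotive.
Variables (R : realType) (F : finFieldType) (X : curve F).
Variables (I : infty_fields R X) (L : coeff_field I) (LA : tensorLA L).
Variables (d : nat) (phi : anderson L d).
Local Notation inL := (LA_L LA).
Local Notation inA := (LA_A LA).
Local Notation N := (dual_motive LA phi).
Local Notation frobL := (frob (cstL L)).
Local Notation frobVL := (frobV (cstL L)).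

Lemma dual_scaleLA l a (n : N) : (inL l * inA a) *: n =
  skewC frobVL l *: ((n : 'rV[Lsigma L]_d) *m adjmx (phi a)) :> 'rV_d.
Proof. exact: (tensor_scale_pure (LA_tensor LA) (dual_motive_actions phi)). Qed.

Lemma dual_scaleL l (n : N) :
  inL l *: n = skewC frobVL l *: (n : 'rV[Lsigma L]_d) :> 'rV_d.
Proof.
have := dual_scaleLA l 1 n; rewrite rmorph1 mulr1 => ->.
by rewrite (aact1 (dual_motive_actions phi)).
Qed.

Lemma dual_scaleA a (n : N) :
  inA a *: n = (n : 'rV[Lsigma L]_d) *m adjmx (phi a) :> 'rV_d.
Proof.
have := dual_scaleLA 1 a n; rewrite rmorph1 mul1r => ->.
by rewrite rmorph1 scale1r.
Qed.

Definition dual_coef (n : N) (k : 'I_d) (j : nat) : L :=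
  skewcoef ((n : 'rV[Lsigma L]_d) 0 k) j.

Lemma dual_coefP (n n' : N) :
  (forall k j, dual_coef n k j = dual_coef n' k j) -> n = n'.
Proof. by move=> h; apply/rowP => k; apply/skewpolyP => j; exact: h. Qed.

Lemma dual_coefD (n n' : N) k j :
  dual_coef (n + n') k j = dual_coef n k j + dual_coef n' k j.
Proof. by rewrite /dual_coef mxE skewcoefD. Qed.

Lemma dual_coef0 k j : dual_coef 0 k j = 0.
Proof. by rewrite /dual_coef mxE /skewcoef coef0. Qed.

Lemma dual_coef_sum (J : Type) (r : seq J) (G : J -> N) k j :
  dual_coef (\sum_(i <- r) G i) k j = \sum_(i <- r) dual_coef (G i) k j.
Proof.
apply: (big_morph (fun n => dual_coef n k j)) => [n n'|].
  exact: dual_coefD.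
exact: dual_coef0.
Qed.

Lemma skewcoefCM (s : {rmorphism L -> L}) c (p : skewpoly s) j :
  skewcoef (skewC s c * p) j = c * skewcoef p j.
Proof.
rewrite skewcoefM big_ord_recl subn0 big1 ?addr0 => [|i _].
  by rewrite skewcoefC.
by rewrite skewcoefC mul0r.
Qed.

Lemma skewcoefXM (s : {rmorphism L -> L}) (p : skewpoly s) j :
  skewcoef (skewX s * p) j = if j is j'.+1 then s (skewcoef p j') else 0.
Proof.
rewrite skewcoefM big_ord_recl skewcoefX mul0r add0r.
case: j => [|j]; first by rewrite big_ord0.
rewrite big_ord_recl skewcoefX mul1r subSS subn0 big1 ?addr0 // => i _.
by rewrite skewcoefX mul0r.
Qed.

Lemma dual_coefL l (n : N) k j :
  dual_coef (inL l *: n) k j = l * dual_coef n k j.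
Proof. by rewrite /dual_coef dual_scaleL mxE skewcoefCM. Qed.

Lemma dual_coef_sigma (n : N) k j : dual_coef (dual_sigma n) k j =
  if j is j'.+1 then frobVL (dual_coef n k j') else 0.
Proof. by rewrite /dual_coef mxE skewcoefXM. Qed.

Lemma dual_coef_gen l k j : dual_coef (dual_gen LA phi l) k j =
  ((k == l) && (j == 0%N))%:R.
Proof.
rewrite /dual_coef mxE /=; case: eqP => _ /=.
  by rewrite /skewcoef coef1.
by rewrite /skewcoef coef0.
Qed.

Lemma dual_sigmaD : {morph @dual_sigma _ _ _ _ _ LA _ phi : x y / x + y}.
Proof.
move=> x y; apply: dual_coefP => k [|j]; rewrite dual_coefD !dual_coef_sigma.
  by rewrite addr0.
by rewrite dual_coefD rmorphD.
Qed.

Lemma dual_sigmaL l (n : N) :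
  dual_sigma (inL l *: n) = inL (frobVL l) *: dual_sigma n.
Proof.
apply: dual_coefP => k [|j].
  by rewrite dual_coefL !dual_coef_sigma mulr0.
by rewrite dual_coefL !dual_coef_sigma dual_coefL rmorphM.
Qed.

Lemma dual_sigmaA a (n : N) :
  dual_sigma (inA a *: n) = inA a *: dual_sigma n.
Proof.
by rewrite dual_scaleA /dual_sigma dual_scaleA scalemxAl.
Qed.

Lemma dual_sigmaZ t (n : N) :
  dual_sigma (t *: n) = twist (-1) t *: dual_sigma n.
Proof.
move: t; apply: (tensor_eq (LA_tensor LA)
  (g := fun t => dual_sigma (t *: n))
  (h := fun t => twist (-1) t *: dual_sigma n)) => [s t|s t|l a].
- by rewrite scalerDl dual_sigmaD.
- by rewrite rmorphD scalerDl.
- by rewrite -scalerA dual_sigmaL dual_sigmaA scalerA twist_pure.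
Qed.

Lemma dual_sigma_eq0 (n : N) : dual_sigma n = 0 -> n = 0.
Proof.
move=> n0; apply: dual_coefP => k j; rewrite dual_coef0.
have := dual_coef_sigma n k j.+1; rewrite n0 dual_coef0 => /esym/eqP.
by rewrite fmorph_eq0 => /eqP.
Qed.

(** Division by sigma after dropping constant terms. Coefficients are raised to the q-th power
    because multiplying by sigma on the left takes q-th roots. *)
Definition dual_shift (n : N) : N := \row_k
  (\poly_(j < (size ((n : 'rV[Lsigma L]_d) 0 k : {poly L})))
     frobL (dual_coef n k j.+1) : Lsigma L).

Lemma dual_coef_shift n k j :
  dual_coef (dual_shift n) k j = frobL (dual_coef n k j.+1).
Proof.
rewrite {1}/dual_coef mxE {1}/skewcoef coef_poly; case: ltnP => // h.
by rewrite /dual_coef /skewcoef nth_default ?rmorph0 // ltnW.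
Qed.

Lemma dual_decomp (n : N) :
  n = \sum_l inL (dual_coef n l 0) *: dual_gen LA phi l
      + dual_sigma (dual_shift n).
Proof.
apply: dual_coefP => k j; rewrite dual_coefD dual_coef_sum dual_coef_sigma.
rewrite (bigD1 k) //= big1 => [|l lk]; last first.
  by rewrite dual_coefL dual_coef_gen eq_sym (negPf lk) mulr0.
rewrite dual_coefL dual_coef_gen eqxx addr0.
by case: j => [|j]; rewrite ?mulr1 ?addr0 // mulr0 add0r dual_coef_shift frobK.
Qed.

Lemma deltaNE (n : N) k : deltaN n k 0 = dual_coef n k 0.
Proof. by rewrite mxE. Qed.

Lemma deltaND : {morph @deltaN _ _ _ _ _ LA _ phi : x y / x + y}.
Proof.
by move=> x y; apply/colP => k; rewrite [RHS]mxE !deltaNE dual_coefD.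
Qed.

Lemma deltaN_sigma (n : N) : deltaN (dual_sigma n) = 0.
Proof. by apply/colP => k; rewrite deltaNE dual_coef_sigma [RHS]mxE. Qed.

Lemma deltaNB (n n' : N) : deltaN (n - n') = deltaN n - deltaN n'.
Proof. by apply/(canRL (addrK _)); rewrite -deltaND subrK. Qed.

Lemma deltaNL l (n : N) : deltaN (inL l *: n) = l *: deltaN n.
Proof. by apply/colP => k; rewrite [RHS]mxE !deltaNE dual_coefL. Qed.

(** Taking constant coefficients is multiplicative on L[sigma], and the constant part of phi_a^* is
    the transpose of d[a]. *)
Lemma deltaNA a (n : N) : deltaN (inA a *: n) = coefmx 0 (phi a) *m deltaN n.
Proof.
apply/colP => k; rewrite deltaNE /dual_coef dual_scaleA !mxE.
rewrite (big_morph (fun p : Lsigma L => skewcoef p 0)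
  (fun p q => skewcoefD p q 0) (coef0 _ 0)).
by apply: eq_bigr => l _; rewrite skewcoefM big_ord1 /= !mxE skewcoef_adj mulrC.
Qed.

Lemma deltaN_gen k : deltaN (dual_gen LA phi k) = delta_mx k 0.
Proof.
by apply/colP => l; rewrite deltaNE dual_coef_gen [RHS]mxE andbC.
Qed.

(** Although sigma is only semilinear, t sigma(x) = sigma(t^(1) x). *)
Lemma range_sigma_submodule :
  submodule_set (range (@dual_sigma _ _ _ _ _ LA _ phi)).
Proof.
split=> [|_ _ [x _ <-] [y _ <-]|t _ [x _ <-]].
- by exists 0 => //; apply: dual_coefP => k [|j];
    rewrite dual_coef_sigma !dual_coef0 ?rmorph0.
- by exists (x + y) => //; rewrite dual_sigmaD.
- by exists (twist 1 t *: x) => //; rewrite dual_sigmaZ twist1K.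
Qed.

End DualMotive.

(** * The map sigma on N_Q and the extension of delta_0 to N_J *)

Section DualMotiveFractions.
Variables (R : realType) (F : finFieldType) (X : curve F).
Variables (I : infty_fields R X) (L : coeff_field I) (LA : tensorLA L).
Variables (d : nat) (phi : anderson L d).
Variable NQ : frac_module (dual_motive LA phi).
Local Notation inL := (LA_L LA).
Local Notation inA := (LA_A LA).
Local Notation N := (dual_motive LA phi).
Local Notation frobL := (frob (cstL L)).
Local Notation frobVL := (frobV (cstL L)).
Local Notation inN := (frac_module_in NQ).
Local Notation "x %:F" := (@FracField.tofrac LA x).
Local Notation twist1 := (@twist _ _ _ _ _ LA 1).
Local Notation sigQ := (@sigmaQ _ _ _ _ _ _ _ _ NQ).
Local Notation sigQV := (@sigmaQV _ _ _ _ _ _ _ _ NQ).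
Local Notation J := (@Jideal _ _ _ _ _ LA 0).
Local Notation h_ := (dual_gen LA phi).

Hypotheses (fgN : fg_module N) (prN : projective_module N).
Variable n0 : nat.
Hypothesis Jn0 : Jpow_sub_sigma LA phi n0.

Let inN_inj : injective inN := frac_in_inj (MQ := NQ) fgN prN.

Let twistN1_inj : injective (@twist _ _ _ _ _ LA (-1)).
Proof. exact: can_inj (@twistN1K _ _ _ _ _ LA). Qed.

Let sigma_bal : balanced (fun (t : LA) (n : N) => t *: n)
  (fun t f => t%:F * f)
  (fun n f => twistQ (-1) f *: inN (dual_sigma n)).
Proof.
split=> [n n' f|n f f'|t n f].
- by rewrite dual_sigmaD frac_inD scalerDr.
- by rewrite [twistQ _ _](frac_mapD twistN1_inj) scalerDl.
- rewrite dual_sigmaZ frac_inZ scalerA.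
  rewrite [twistQ _ (_ * _)](frac_mapM twistN1_inj).
  by rewrite (frac_map_tofrac twistN1_inj) mulrC.
Qed.

Lemma sigmaQD : {morph sigQ : x y / x + y}.
Proof. exact: (tensor_liftP (frac_module_tensor NQ) sigma_bal).1. Qed.

Lemma sigmaQ_pure f n :
  sigQ (f *: inN n) = twistQ (-1) f *: inN (dual_sigma n).
Proof. exact: (tensor_liftP (frac_module_tensor NQ) sigma_bal).2. Qed.

Lemma sigmaQ_divr t n :
  sigQ (t%:F^-1 *: inN n) = (twist (-1) t)%:F^-1 *: inN (dual_sigma n).
Proof. by rewrite sigmaQ_pure [twistQ _ _](frac_mapV twistN1_inj). Qed.

Lemma sigmaQZ t x : sigQ (t%:F *: x) = (twist (-1) t)%:F *: sigQ x.
Proof.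
have [n [s [_ ->]]] := frac_module_den x.
rewrite scalerA !sigmaQ_pure scalerA [twistQ _ (_ * _)](frac_mapM twistN1_inj).
by rewrite (frac_map_tofrac twistN1_inj).
Qed.

Lemma sigmaQ_in n : sigQ (inN n) = inN (dual_sigma n).
Proof.
by have := sigmaQ_divr 1 n; rewrite !rmorph1 !invr1 !scale1r.
Qed.

(** If sigma kills n/s, then sigma n vanishes in N_Q, hence in N, which embeds; and sigma is
    injective on N. This makes the preimage chosen by [sigmaQV] unique. *)
Lemma sigmaQ_inj : injective sigQ.
Proof.
suff sig0 x : sigQ x = 0 -> x = 0.
  move=> x y xy; apply/subr0_eq/sig0; rewrite sigmaQD xy.
  rewrite -scaleN1r -(rmorph1 (@FracField.tofrac LA)) -rmorphN sigmaQZ.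
  by rewrite !rmorphN !rmorph1 scaleN1r subrr.
have [n [s [s0 ->]]] := frac_module_den x; rewrite sigmaQ_divr => /eqP.
rewrite scaler_eq0 invr_eq0 tofrac_eq0 raddf_eq0 // (negPf s0) /= => /eqP.
rewrite -(frac_in0 NQ) => /inN_inj/dual_sigma_eq0 ->.
by rewrite frac_in0 scaler0.
Qed.

(** The localization of sigma N at J: congruence modulo it is what determines delta_0. *)
Definition sigmaJ : set NQ := loc_sub (range (@dual_sigma _ _ _ _ _ LA _ phi))
  (~` J).

Let sigmaJ_submodule := loc_sub_submodule NQ
  (range_sigma_submodule LA phi) (mult_set_NJ LA).

Let setT_submodule : submodule_set [set: N]. Proof. by []. Qed.
Let NJ_submodule := loc_sub_submodule NQ setT_submodule (mult_set_NJ LA).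

Lemma NJE (x : NQ) : NJ x <-> loc_sub [set: N] (~` J) x.
Proof.
by split=> [[m [s [Js ->]]]|[m [s [_ Js ->]]]]; exists m, s.
Qed.

(* s is invertible modulo every power of J, since LA / J = L is a field.     *)
Lemma coprime_Jpow s k : ~ J s -> exists t w, J w /\ 1 = s * t + w ^+ k.
Proof.
move=> Js; have es : Xi_eval s != 0 by apply: contra_notN Js => /eqP/JidealP.
pose u := inL (Xi_eval s)^-1; pose w := 1 - s * u.
exists (u * \sum_(i < k) w ^+ i), w; split.
  by apply/JidealP; rewrite rmorphB rmorphM rmorph1 /= Xi_evalL divff ?subrr.
have -> : w ^+ k = 1 - s * u * \sum_(i < k) w ^+ i.
  have <- : 1 - w = s * u by rewrite /w subKr.
  by rewrite -[LHS](subrK 1) subrX1 addrC -[w - 1]opprB mulNr.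
by rewrite mulrA addrC subrK.
Qed.

Let divr_coprime s t w : s != 0 -> 1 = s * t + w ->
  s%:F^-1 - t%:F = w%:F * s%:F^-1.
Proof.
move=> s0 /(congr1 (@FracField.tofrac LA)).
rewrite rmorphD rmorph1 rmorphM => st.
rewrite -[X in X - _]mulr1 st mulrDr mulKf ?tofrac_eq0 //.
by rewrite addrAC subrr add0r mulrC.
Qed.

(** Some s outside J has s n in sigma N. Writing 1 = s t + w^n0 with w in J gives n = t (s n) + w^n0
    n, and both summands lie in sigma N. *)
Lemma deltaN_sigmaJ n : sigmaJ (inN n) -> deltaN n = 0.
Proof.
move=> [p [s [sp Js ns]]].
have s0 : s != 0 by have [_ S0 _] := mult_set_NJ LA; exact: S0.
have sn : s *: n = p.
  apply: inN_inj; rewrite frac_inZ ns scalerA divff ?tofrac_eq0 //.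
  by rewrite scale1r.
have [t [w [Jw st]]] := coprime_Jpow n0 Js.
have [S0 SD SZ] := range_sigma_submodule LA phi.
suff [n' _ <-] : range (@dual_sigma _ _ _ _ _ LA _ phi) n.
  exact: deltaN_sigma.
rewrite -[n]scale1r st scalerDl; apply: SD.
  by rewrite mulrC -scalerA sn; exact: SZ.
by apply: Jn0; exact: iter_ideal_mul_exp.
Qed.

(** The representative n' chosen by [deltaNJ] differs from x by an element of J^m N_J, which lies in
    the localization of sigma N; so n' - n lies there too and is killed by delta_0. *)
Lemma deltaNJ_eq x n : sigmaJ (x - inN n) -> deltaNJ x = deltaN n.
Proof.
move=> xn; have [_ sD sZ] := sigmaJ_submodule; have [_ nD _] := NJ_submodule.
have NJx : NJ x.
  apply/NJE; rewrite -[x](subrK (inN n)); apply: nD.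
    by case: xn => p [s [_ Js ->]]; exists p, s.
  exists n, 1; split=> //; first by have [] := mult_set_NJ LA.
  by rewrite rmorph1 invr1 scale1r.
rewrite /deltaNJ; set Y := [set n | _].
(* The choice is not the default 0: for x = p/s and 1 = s t + w^n0, the element t p is a
   representative, since x - t p = w^n0 x. *)
have [m Jm] : Y (xget 0 Y).
  apply: xgetPex; case: NJx => p [s [Js xE]].
  have [t [w [Jw st]]] := coprime_Jpow n0 Js.
  exists (t *: p); exists n0 => //; rewrite xE.
  have s0 : s != 0 by have [_ S0 _] := mult_set_NJ LA; exact: S0.
  have -> : s%:F^-1 *: inN p - inN (t *: p) =
      w%:F ^+ n0 *: (s%:F^-1 *: inN p).
    by rewrite frac_inZ -scalerBl scalerA (divr_coprime s0 st) rmorphXn.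
  by apply: iter_ideal_mul_exp; [exists w|exists p, s].
move: (xget 0 Y) => n' xn'.
apply/subr0_eq; rewrite -deltaNB; apply: deltaN_sigmaJ.
rewrite frac_inB -(subrKA x) -[inN n' - x]opprB.
rewrite -[- (x - inN n')]scaleN1r.
rewrite -(rmorph1 (@FracField.tofrac LA)) -rmorphN; apply: sD; last exact: xn.
apply: sZ.
have [p [s [/Jm pJ Js ->]]] := iter_ideal_mul_loc (mult_set_NJ LA) xn'.
by exists p, s.
Qed.

Lemma sigmaJ_exists (x : NQ) : NJ x -> exists n, sigmaJ (x - inN n).
Proof.
move=> [p [s [Js ->]]]; have [t [w [Jw st]]] := coprime_Jpow n0 Js.
have s0 : s != 0 by have [_ S0 _] := mult_set_NJ LA; exact: S0.
exists (t *: p), (w ^+ n0 *: p), s; split=> //.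
  by apply: Jn0; exact: iter_ideal_mul_exp.
by rewrite !frac_inZ scalerA -scalerBl (divr_coprime s0 st) mulrC.
Qed.

Lemma deltaNJ_in n : deltaNJ (inN n) = deltaN n.
Proof. by apply: deltaNJ_eq; rewrite subrr; have [] := sigmaJ_submodule. Qed.

Lemma deltaNJD (x y : NQ) :
  NJ x -> NJ y -> deltaNJ (x + y) = deltaNJ x + deltaNJ y.
Proof.
move=> /sigmaJ_exists[n xn] /sigmaJ_exists[m ym].
rewrite (deltaNJ_eq xn) (deltaNJ_eq ym) -deltaND; apply: deltaNJ_eq.
have [_ sD _] := sigmaJ_submodule.
by rewrite frac_inD opprD addrACA; exact: sD.
Qed.

Let sigmaJZ t x n : sigmaJ (x - inN n) -> sigmaJ (t%:F *: x - inN (t *: n)).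
Proof.
have [_ _ sZ] := sigmaJ_submodule.
by move=> xn; rewrite frac_inZ -scalerBr; exact: sZ.
Qed.

Lemma deltaNJL l (x : NQ) : NJ x -> deltaNJ ((inL l)%:F *: x) = l *: deltaNJ x.
Proof.
move=> /sigmaJ_exists[n xn]; rewrite (deltaNJ_eq xn) -deltaNL.
by apply: deltaNJ_eq; exact: sigmaJZ.
Qed.

Lemma deltaNJA a (x : NQ) : NJ x ->
  deltaNJ ((inA a)%:F *: x) = coefmx 0 (phi a) *m deltaNJ x.
Proof.
move=> /sigmaJ_exists[n xn]; rewrite (deltaNJ_eq xn) -deltaNA.
by apply: deltaNJ_eq; exact: sigmaJZ.
Qed.

(** * Inverting sigma inside N_J *)

Variable a0 : affine X.
Hypothesis a0P : forall i, iter i.+1 frobL (A_L L a0) != A_L L a0.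

(** The elements outside J^(-i) for every i >= 0: denominators that stay prime to J under all
    further twists. *)
Definition twist_units : set LA :=
  [set u | forall i, Xi_eval (iter i twist1 u) != 0].

Let iter_twist1 i : iter i twist1 1 = 1.
Proof. by elim: i => //= i ->; rewrite rmorph1. Qed.

Lemma iter_twistM i : {morph iter i twist1 : x y / x * y}.
Proof. by move=> x y; elim: i => //= i ->; rewrite rmorphM. Qed.

Lemma mult_set_twist_units : mult_set twist_units.
Proof.
split=> [i|s /(_ 0%N)|s t Ss St i].
- by rewrite iter_twist1 rmorph1 oner_neq0.
- by apply: contraNneq => ->; rewrite rmorph0.
- by rewrite iter_twistM rmorphM; apply: mulf_neq0; [exact: Ss|exact: St].
Qed.

Let w0 := inA a0 - inL (A_L L a0).

Let w0_J : J w0.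
Proof. by apply/JidealP; rewrite rmorphB /= Xi_evalA Xi_evalL subrr. Qed.

(** At Xi, the twist w0^(i+1) takes the value a0 - a0^(q^(i+1)). *)
Let w0_units : twist_units (twist1 w0).
Proof.
move=> i; rewrite -iterSr.
have -> : iter i.+1 twist1 w0 = inA a0 - inL (iter i.+1 frobL (A_L L a0)).
  by elim: i.+1 => [|j IH] //; rewrite !iterS IH rmorphB /= twistA twistL.
by rewrite rmorphB /= Xi_evalA Xi_evalL subr_eq0 eq_sym; exact: a0P.
Qed.

Definition sigma_dom : set NQ := loc_sub [set: N] twist_units.

Let dom_submodule := loc_sub_submodule NQ setT_submodule mult_set_twist_units.

Lemma sigma_dom_NJ x : sigma_dom x -> NJ x.
Proof.
move=> [n [s [_ Ss ->]]]; exists n, s; split=> // /JidealP.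
exact/eqP/(Ss 0%N).
Qed.

Lemma sigma_dom_in n : sigma_dom (inN n).
Proof.
exists n, 1; split=> //; first by have [] := mult_set_twist_units.
by rewrite rmorph1 invr1 scale1r.
Qed.

(** For y = n/u, the element w0^n0 n of J^n0 N equals sigma n' for some n'. Then y = sigma(n') / (u
    w0^n0), so sigma^-1 y = n' / (u w0^n0)^(1), again with an admissible denominator. *)
Lemma sigmaQV_dom y : sigma_dom y -> sigQ (sigQV y) = y /\ sigma_dom (sigQV y).
Proof.
move=> [n [u [_ Su yE]]].
have [n' _ n'E] : range (@dual_sigma _ _ _ _ _ LA _ phi) (w0 ^+ n0 *: n).
  by apply: Jn0; exact: iter_ideal_mul_exp.
pose x : NQ := (twist1 (u * w0 ^+ n0))%:F^-1 *: inN n'.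
have [S1 S0 SM] := mult_set_twist_units.
have SX k : twist_units (twist1 w0 ^+ k).
  by elim: k => [|k IH]; rewrite ?expr0 // exprS; exact: SM.
have w00 : w0 != 0 by apply: contra_neq (S0 _ w0_units) => ->; rewrite rmorph0.
have xy : sigQ x = y.
  rewrite sigmaQ_divr twist1K n'E frac_inZ scalerA rmorphM invfM yE.
  by rewrite mulfVK // tofrac_eq0 expf_neq0.
have yx : sigQ (sigQV y) = y.
  by apply: (@xgetPex _ 0 [set x | sigQ x = y]); exists x.
split=> //; have -> : sigQV y = x by apply: sigmaQ_inj; rewrite yx xy.
exists n', (twist1 (u * w0 ^+ n0)); split=> //.
rewrite rmorphM; apply: SM; first by move=> i; rewrite -iterSr.
by rewrite rmorphXn; exact: SX.
Qed.

Lemma iter_sigmaQV_dom i y : sigma_dom y -> sigma_dom (iter i sigQV y).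
Proof. by move=> yd; elim: i => //= i /sigmaQV_dom[]. Qed.

Lemma sigmaQVK x : sigma_dom (sigQ x) -> sigQV (sigQ x) = x.
Proof. by move=> /sigmaQV_dom[h _]; exact: sigmaQ_inj. Qed.

Lemma iter_sigmaQVD i x y : sigma_dom x -> sigma_dom y ->
  iter i sigQV (x + y) = iter i sigQV x + iter i sigQV y.
Proof.
move=> xd yd; have [_ dD _] := dom_submodule.
elim: i => //= i ->.
have ix := iter_sigmaQV_dom i xd; have iy := iter_sigmaQV_dom i yd.
have [hxy _] := sigmaQV_dom (dD _ _ ix iy).
apply: sigmaQ_inj; rewrite hxy sigmaQD.
by rewrite (sigmaQV_dom ix).1 (sigmaQV_dom iy).1.
Qed.

Lemma iter_sigmaQVZ i t x : sigma_dom x ->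
  iter i sigQV (t%:F *: x) = (iter i twist1 t)%:F *: iter i sigQV x.
Proof.
move=> xd; have [_ _ dZ] := dom_submodule.
elim: i => //= i ->; have ix := iter_sigmaQV_dom i xd.
have [h _] := sigmaQV_dom (dZ (iter i twist1 t) _ ix).
by apply: sigmaQ_inj; rewrite h sigmaQZ (sigmaQV_dom ix).1 twist1K.
Qed.

Lemma iter_sigmaQV_sum i (K : Type) (s : seq K) (G : K -> NQ) :
  (forall k, sigma_dom (G k)) ->
  iter i sigQV (\sum_(k <- s) G k) = \sum_(k <- s) iter i sigQV (G k) /\
  sigma_dom (\sum_(k <- s) G k).
Proof.
move=> Gd; have [d0 dD _] := dom_submodule.
elim: s => [|k s [IH IHd]]; rewrite ?big_nil ?big_cons; last first.
  by rewrite iter_sigmaQVD // IH; split=> //; apply: dD => //; exact: Gd.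
split=> //; apply: (addrI (iter i sigQV 0)).
by rewrite -iter_sigmaQVD // !addr0.
Qed.

Lemma deltaNJ_sum (K : Type) (s : seq K) (G : K -> NQ) :
  (forall k, sigma_dom (G k)) ->
  deltaNJ (\sum_(k <- s) G k) = \sum_(k <- s) deltaNJ (G k).
Proof.
move=> Gd; elim: s => [|k s IH]; rewrite ?big_nil ?big_cons.
  rewrite -(frac_in0 NQ) deltaNJ_in; apply/colP => l.
  by rewrite deltaNE dual_coef0 mxE.
rewrite deltaNJD ?IH //; first exact: sigma_dom_NJ.
exact/sigma_dom_NJ/(iter_sigmaQV_sum 0 s Gd).2.
Qed.

(** * The matrices P'_i and their recursion *)

Definition log_col (i : nat) (k : 'I_d) : 'cV[L]_d :=
  deltaNJ (iter i sigQV (inN (h_ k))).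

Let iter_twistL i l : iter i twist1 (inL l) = inL (iter i frobL l).
Proof. by elim: i => //= i ->; rewrite twistL. Qed.

Let iter_twistA i a : iter i twist1 (inA a) = inA a.
Proof. by elim: i => //= i ->; rewrite twistA. Qed.

Let log_col_lin i (c : 'I_d -> L) :
  deltaNJ (iter i sigQV (inN (\sum_l inL (c l) *: h_ l)))
    = \sum_l iter i frobL (c l) *: log_col i l.
Proof.
have Gd l := sigma_dom_in (inL (c l) *: h_ l).
rewrite frac_in_sum (iter_sigmaQV_sum i _ Gd).1 deltaNJ_sum => [|l]; last first.
  exact: iter_sigmaQV_dom.
apply: eq_bigr => l _; rewrite frac_inZ iter_sigmaQVZ; last exact: sigma_dom_in.
rewrite iter_twistL deltaNJL //.
exact/sigma_dom_NJ/iter_sigmaQV_dom/sigma_dom_in.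
Qed.

(** By [dual_decomp], n is its constant part, which gives the summand j = 0, plus sigma n'. One
    sigma^-1 cancels that sigma and induction applies to n'; for i = 0, delta_0 kills sigma n'. *)
Lemma deltaNJ_iter_sigmaQV i (n : N) : deltaNJ (iter i sigQV (inN n)) =
  \sum_(j < i.+1) \sum_l iter i frobL (dual_coef n l j) *: log_col (i - j) l.
Proof.
have dom m : sigma_dom (inN m) := sigma_dom_in m.
elim: i n => [|i IH] n; rewrite {1}(dual_decomp n) frac_inD iter_sigmaQVD //;
  rewrite deltaNJD; try exact/sigma_dom_NJ/iter_sigmaQV_dom/dom;
  rewrite log_col_lin big_ord_recl subn0; congr (_ + _).
  by rewrite big_ord0 deltaNJ_in deltaN_sigma.
rewrite iterSr -sigmaQ_in sigmaQVK ?sigmaQ_in // IH.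
apply: eq_bigr => j _; apply: eq_bigr => l _.
by rewrite dual_coef_shift -iterSr.
Qed.

Definition log_mx (i : nat) : 'M[L]_d := \matrix_(l, k) log_col i k l 0.

Lemma log_mx0 : log_mx 0 = 1%:M.
Proof.
apply/matrixP => l k; rewrite mxE /log_col deltaNJ_in deltaN_gen !mxE.
by rewrite eqxx andbT.
Qed.

Lemma frob_iterVK i j x : (j <= i)%N ->
  iter i frobL (iter j frobVL x) = iter (i - j) frobL x.
Proof.
move=> ji; rewrite -{1}(subnK ji) iterD; congr iter.
by elim: j {ji} => // j IH; rewrite iterSr iterS frobVK.
Qed.

Lemma log_mx_rec a i :
  \sum_(j < i.+1) log_mx (i - j) *m
      map_mx (iter (i - j) frobL) (coefmx j (phi a))
  = coefmx 0 (phi a) *m log_mx i.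
Proof.
apply/matrixP => m k.
have := deltaNJ_iter_sigmaQV i (inA a *: h_ k).
rewrite frac_inZ iter_sigmaQVZ; last exact: sigma_dom_in.
rewrite iter_twistA deltaNJA; last first.
  exact/sigma_dom_NJ/iter_sigmaQV_dom/sigma_dom_in.
move=> /(congr1 (fun v : 'cV_d => v m 0)) e.
transitivity ((coefmx 0 (phi a) *m log_col i k) m 0); last first.
  by rewrite !mxE; apply: eq_bigr => l _; rewrite [log_mx _ _ _]mxE.
rewrite e !summxE; apply: eq_bigr => j _; rewrite mxE summxE.
apply: eq_bigr => l _; rewrite !mxE mulrC; congr (_ * _).
rewrite /dual_coef dual_scaleA -rowE !mxE skewcoef_adj frob_iterVK //.
by rewrite -ltnS.
Qed.

Lemma G_termE (z : 'cV[L]_d) i :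
  G_term NQ z i = log_mx i *m map_mx (iter i frobL) z.
Proof.
(* The only nonzero coefficient of tau^i g_k is a 1 at tau^i in entry k, so evaluating it at z gives
   z_k^(q^i). *)
have tauX k l j : skewcoef
    ((iter i (@motive_tau _ _ _ _ _ LA _ phi) (motive_gen LA phi k)
       : 'rV[Ltau L]_d) 0 l) j = ((l == k) && (j == i))%:R.
  elim: i j => [|i' IH] j /=.
    rewrite mxE /=; case: eqP => _; last by rewrite /skewcoef coef0.
    by rewrite /skewcoef coef1.
  rewrite mxE skewcoefXM; case: j => [|j]; first by rewrite andbF.
  by rewrite IH rmorph_nat.
have deltaMX k : deltaM z (iter i (@motive_tau _ _ _ _ _ LA _ phi)
    (motive_gen LA phi k)) = iter i frobL (z k 0).
  rewrite /deltaM (bigD1 k) //= big1 => [|l lk]; last first.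
    rewrite /tau_eval big1 // => j _.
    by rewrite tauX (negPf lk) mul0r.
  set p := _ 0 k.
  have pE : (p : {poly L}) = 'X^i.
    by apply/polyP => j; rewrite coefXn; have := tauX k k j; rewrite eqxx.
  rewrite addr0 frob_iterE /tau_eval pE size_polyXn big_ord_recr /=.
  rewrite big1 ?add0r => [|j _]; rewrite /skewcoef coefXn ?eqxx ?mul1r //.
  by rewrite ltn_eqF // mul0r.
rewrite /G_term; apply/colP => l; rewrite summxE mxE; apply: eq_bigr => k _.
rewrite deltaMX deltaNJL; last first.
  exact/sigma_dom_NJ/iter_sigmaQV_dom/sigma_dom_in.
by rewrite !mxE mulrC.
Qed.

End DualMotiveFractions.

(** * Nonconstant functions and uniqueness of the logarithm *)

Section Logarithm.
Variables (R : realType) (F : finFieldType) (X : curve F).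
Variables (I : infty_fields R X) (L : coeff_field I).
Variables (d : nat) (phi : anderson L d).
Local Notation frobL := (frob (cstL L)).

(** Such an a is a root of X^q' - X for q' a power of q, hence algebraic over F, which is
    algebraically closed in K. *)
Lemma frob_fixed_cst (a : affine X) i :
  iter i.+1 frobL (A_L L a) = A_L L a -> exists c, a = cstA X c.
Proof.
rewrite frob_iterE /A_L -rmorphXn => /fmorph_inj aE.
set q := (#|F| ^ i.+1)%N in aE.
have q_gt1 : (1 < q)%N.
  by rewrite -(exp1n i.+1) ltn_exp2r // (cardD1 0) (cardD1 1) !inE oner_eq0.
have [c ac] : exists c, affine_val a = cstK X c.
  apply: (funfieldP X).2; exists ('X^q - 'X).
    by rewrite -size_poly_eq0 size_polyDl ?size_polyXn // size_polyN size_polyX.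
  by rewrite rmorphB /= map_polyXn map_polyX rootE !hornerE aE subrr.
by exists c; apply: val_inj.
Qed.

(* Otherwise A = F and LA = L, over which N has infinite dimension.          *)
Lemma exists_nonconstant (LA : tensorLA L) : (0 < d)%N ->
  fg_module (dual_motive LA phi) ->
  exists a, forall i, iter i.+1 frobL (A_L L a) != A_L L a.
Proof.
move=> d_gt0 [s sP]; apply/not_existsP => noa.
have LA_onto t : exists l, t = LA_L LA l.
  move: t; apply: (tensor_ind (LA_tensor LA)) => [|_ _ [l ->] [l' ->]|l a].
  - by exists 0; rewrite rmorph0.
  - by exists (l - l'); rewrite rmorphB.
  have [i /negP/negPn/eqP/frob_fixed_cst[c ->]] := (existsNP _).2 (noa a).
  by exists (l * cstL L c); rewrite rmorphM /= LA_cst.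
pose k0 := Ordinal d_gt0.
pose sz (n : dual_motive LA phi) :=
  size ((n : 'rV[Lsigma L]_d) 0 k0 : {poly L}).
(* No generator has a sigma^b term in entry [k0], and L-combinations create none; the vector with
   all entries sigma^b is thus out of reach. *)
pose b := \max_(k < size s) sz (s`_k)%R.
have [t] := sP ((const_mx (('X^b : {poly L}) : Lsigma L) : 'rV[Lsigma L]_d)
  : dual_motive LA phi).
move/(congr1 (fun n : dual_motive LA phi => dual_coef n k0 b)).
rewrite dual_coef_sum {1}/dual_coef mxE /skewcoef coefXn eqxx.
rewrite big1 => [/eqP|k _].
  by rewrite oner_eq0.
have [l ->] := LA_onto (t k); rewrite dual_coefL /dual_coef /skewcoef.
rewrite nth_default ?mulr0 //.
exact: (leq_bigmax (F := fun k : 'I_(size s) => sz (s`_k)%R) k).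
Qed.

Local Notation LC := (L_C L).

Lemma L_C_frob n x : LC (iter n frobL x) = LC x ^+ (#|F| ^ n).
Proof. by rewrite frob_iterE rmorphXn. Qed.

(** In both recursions the summands with j >= 1 involve only earlier coefficients, which agree by
    induction. The difference D of the n-th coefficients therefore satisfies D d[a]^(n) = d[a] D,
    and [sylvester_eq0] applies. *)
Lemma is_log_unique (P : nat -> 'M[Cinf I]_d) (Pl : nat -> 'M[L]_d)
    (a : affine X) :
  (forall i, iter i.+1 frobL (A_L L a) != A_L L a) -> is_log phi P ->
  Pl 0%N = 1%:M ->
  (forall i, \sum_(j < i.+1) Pl (i - j)%N *m
      map_mx (iter (i - j) frobL) (coefmx j (phi a))
    = coefmx 0 (phi a) *m Pl i) ->
  forall i, P i = map_mx LC (Pl i).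
Proof.
move=> aP [P0 PR] Pl0 PlR; elim/ltn_ind => -[|n] IH.
  by rewrite P0 Pl0 map_mx1.
have [k Nk] := anderson_nilpotent phi a.
(* Stated for any ring morphism f so as to cover both d[a] and its Frobenius twist. *)
have nilp (f : {rmorphism L -> Cinf I}) :
    (map_mx f (coefmx 0 (phi a)) - (f (A_L L a))%:M) ^+ k = 0.
  rewrite -map_scalar_mx -map_mxB.
  have mapX (B : 'M[L]_d) m : map_mx f B ^+ m = map_mx f (B ^+ m).
    elim: m => [|m IHm]; first by rewrite !expr0 [RHS]map_mx1.
    by rewrite !exprS IHm [RHS]map_mxM.
  by rewrite mapX Nk map_mx0.
apply/subr0_eq.
apply: (sylvester_eq0 _ (nilp LC) (nilp (LC \o frobz (cstL L) n.+1))).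
  by rewrite /= fmorph_eq eq_sym; exact: aP.
rewrite mulmxBl mulmxBr.
have := PR a n.+1; rewrite big_ord_recl subn0 => /(canRL (addrK _)) PRn.
have := congr1 (map_mx LC) (PlR n.+1).
rewrite big_ord_recl subn0 map_mxD !map_mxM => /(canRL (addrK _)) PlRn.
have frob1 : map_mx LC (map_mx (iter n.+1 frobL) (coefmx 0 (phi a)))
    = map_mx (LC \o frobz (cstL L) n.+1) (coefmx 0 (phi a)).
  by apply/matrixP => i j; rewrite !mxE.
have frob2 : map_mx (fun x => LC x ^+ (#|F| ^ n.+1)) (coefmx 0 (phi a))
    = map_mx (LC \o frobz (cstL L) n.+1) (coefmx 0 (phi a)).
  by apply/matrixP => i j; rewrite !mxE /= -L_C_frob.
rewrite -[nat_of_ord ord0]/0%N frob1 in PlRn.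
rewrite -[nat_of_ord ord0]/0%N frob2 in PRn.
rewrite PlRn PRn opprB addrA; congr (_ - _).
rewrite -[RHS](subrK (map_mx LC (\sum_(j < n.+1) Pl (n.+1 - lift ord0 j)%N *m
  map_mx (iter (n.+1 - lift ord0 j) frobL) (coefmx (lift ord0 j) (phi a))))).
congr (_ - _ + _).
rewrite raddf_sum; apply: eq_bigr => j _.
rewrite [RHS]map_mxM IH; last by rewrite lift0 subSS ltnS leq_subr.
by congr (_ *m _); apply/matrixP => u v; rewrite !mxE L_C_frob.
Qed.

End Logarithm.

Theorem theorem4p4 (R : realType) (F : finFieldType) (X : curve F)
    (I : infty_fields R X) (L : coeff_field I) (LA : tensorLA L)
    (d r : nat) (phi : anderson L d)
    (MQ : frac_module (motive LA phi)) (NQ : frac_module (dual_motive LA phi))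
    (P : nat -> 'M[Cinf I]_d) :
  abelian_motive MQ r -> A_finite_dual_motive NQ r -> Xi_regular MQ NQ r ->
  is_log phi P ->
  forall z : 'cV[L]_d, log_domain P (map_mx (L_C L) z) ->
    vseries_cvg (fun i => map_mx (L_C L) (G_term NQ z i))
                (Log P (map_mx (L_C L) z)).
Proof.
move=> _ [fgN prN _ [n0 /(_ _ (leqnn _)) Jn0]] _ PP z [w zw] k.
(* Convergence is coordinatewise, so a coordinate k is at hand and d is positive. *)
have d_gt0 : (0 < d)%N by exact: leq_ltn_trans (ltn_ord k).
move: k; rewrite -/(vseries_cvg _ _).
have [a aP] := exists_nonconstant d_gt0 fgN.
have PE := is_log_unique aP PP (log_mx0 NQ fgN prN Jn0)
  (log_mx_rec NQ fgN prN Jn0 aP a).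
have -> : (fun i => map_mx (L_C L) (G_term NQ z i))
    = log_term P (map_mx (L_C L) z).
  apply/funext => i; rewrite (G_termE NQ fgN prN Jn0 aP) map_mxM /log_term PE.
  by congr (_ *m _); apply/matrixP => l m; rewrite !mxE L_C_frob.
(* As z lies in the domain, the value chosen by [Log] is a genuine limit and not the default 0. *)
by apply: (@xgetPex _ 0 [set v | vseries_cvg _ v] _); exists w.
Qed.
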